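(* Let $n,m,r\ge 1$ and $k\ge 2$ be integers, let $A\in\mathbb{R}^{n\times n}$, $B\in\mathbb{R}^{n\times m}$, $C\in\mathbb{R}^{r\times n}$, $D\in\mathbb{R}^{r\times m}$, and consider the system $x_{t+1}=Ax_t+Bu_t+w_t$, $y_t=Cx_t+Du_t$, $t=0,1,\dots$, with random initial state $x_0\in\mathbb{R}^n$, random control inputs $u_t\in\mathbb{R}^m$ and random attacks $w_t\in\mathbb{R}^n$. Let $G^*=[D~~CB~~CAB~~\cdots~~CA^{k-2}B]\in\mathbb{R}^{r\times mk}$ and $\mathbf{U}_t^{(k)}=[u_t^T~u_{t-1}^T~\cdots~u_{t-k+1}^T]^T\in\mathbb{R}^{mk}$, and let $\mathcal{F}_t=\sigma(x_0,w_0,\dots,w_{t-1})$. Assume: (i) there are $\psi>0$ and $0\le\rho<1$ with $\|A^t\|_2\le\psi\rho^t$ for all $t\ge0$; (ii) there is $\eta>0$ such that $\|x_0\|_{\psi_2}\le\eta$ and, conditionally on $\mathcal{F}_t$, $\|w_t\|_{\psi_2}\le\eta$ for all $t\ge0$; (iii) for some $0\le p<\frac{1}{2(k-1)}$ there is a sequence $(\xi_t)_{t\ge0}$ of independent $\mathrm{Bernoulli}(p)$ variables, with $\xi_t$ independent of $\mathcal{F}_t$ for each $t$, such that $\{\xi_t=0\}\subseteq\{w_t=0\}$ for all $t\ge0$; (iv) the control inputs $u_t$ are independent with $u_t\sim N(0,\sigma^2I_m)$, $\sigma>0$. Let $q=1-(1-p)^{k-1}$ and $\nu=\frac{\|C\|_2}{1-2q}\left(\frac{\eta}{\sigma}+\sqrt{m}\,\|B\|_2\right)$.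 Let $0<\alpha\le1$ and let $G^{(t)}$, $t\in\{0,k,2k,\dots\}$, be generated by the stochastic subgradient method with the ''best'' step size: $G^{(0)}=0$ and, for $t=0,k,2k,\dots$, with $f_t(G)=\|y_{t+k-1}-G\,\mathbf{U}_{t+k-1}^{(k)}\|_2$, $$g^{(t)}\in\partial f_t(G^{(t)}),\qquad \theta_t=\frac{\langle g^{(t)},G^{(t)}-G^*\rangle}{\|g^{(t)}\|_F^2},\qquad G^{(t+k)}=G^{(t)}-\gamma_tg^{(t)},$$ where $g^{(t)}$ is a nonzero subgradient and $\gamma_t$ is any number between $\alpha\theta_t$ and $(2-\alpha)\theta_t$ (inclusive). Then there is a constant $K>0$ (depending at most on $\psi$) such that for all $t\ge0$ that are multiples of $k$, $$\mathbb{E}\big[\|G^{(t)}-G^*\|_F^2\big]\le K\left[\left(1-\frac{(1-2q)^2(2\alpha-\alpha^2)}{2\pi\, mk}\right)^{t/k}\|G^{(0)}-G^*\|_F^2+\Big(\frac{\rho^{k-1}\nu}{1-\rho}\Big)^2\right].$$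
   Context: $\|\cdot\|_2$ is the Euclidean norm of a vector or the spectral norm of a matrix; $\|\cdot\|_F$ is the Frobenius norm; $\langle\cdot,\cdot\rangle$ is the Frobenius inner product; $\partial f_t$ is the convex subdifferential. For a scalar random variable $X$, $\|X\|_{\psi_2}=\inf\{s>0:\mathbb{E}[e^{X^2/s^2}]\le2\}$; for a random vector $X$, $\|X\|_{\psi_2}$ means $\|\,\|X\|_2\,\|_{\psi_2}$; ''$\|w_t\|_{\psi_2}\le\eta$ conditionally on $\mathcal{F}_t$'' means $\mathbb{E}[e^{\|w_t\|_2^2/\eta^2}\mid\mathcal{F}_t]\le2$ almost surely. Standing convention on the interplay of randomness: for every $t$, the future inputs $(u_s)_{s\ge t}$, the variables $(\xi_s)_{s\ge t}$ and the history $\sigma(x_0,w_0,\dots,w_{t-1},u_0,\dots,u_{t-1})$ are mutually independent. Apart from the stated assumptions, the attacks $w_t$ may be chosen arbitrarily by an adversary using historical information. The selections of $g^{(t)}$ and $\gamma_t$ are measurable functions of $G^{(t)}$, $y_{t+k-1}$, $\mathbf{U}_{t+k-1}^{(k)}$ (and the fixed quantities $G^*,\alpha$). A nonzero subgradient always exists when $\mathbf{U}_{t+k-1}^{(k)}\neq0$, which holds almost surely. *)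

(* Defs.v *)
From HB Require Import structures.
From mathcomp Require Import all_boot all_order all_algebra.
From mathcomp Require Import finmap.
From mathcomp Require Import all_classical all_reals all_analysis measurable_realfun.

Set Implicit Arguments.
Unset Strict Implicit.
Unset Printing Implicit Defensive.

Import Order.TTheory GRing.Theory Num.Theory.
Import numFieldNormedType.Exports.

Local Open Scope classical_set_scope.
Local Open Scope ring_scope.

Definition matrix_display : measure_display -> measure_display.
Proof. exact. Qed.

(* Matrices carry the sigma-algebra generated by their entries; over R this is
   the Borel sigma-algebra of the finite-dimensional space 'M[R]_(m, n). *)
Section measurable_matrix.
Context d (T : measurableType d) (m n : nat).

Definition matrix_measurable : set (set 'M[T]_(m, n)) :=
  <<s \bigcup_(ij in [set: 'I_m * 'I_n])
        preimage_set_system setT (fun M : 'M[T]_(m, n) => M ij.1 ij.2)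
          measurable >>.

Let matrix_measurable0 : matrix_measurable set0.
Proof. exact: sigma_algebra0. Qed.

Let matrix_measurableC A : matrix_measurable A -> matrix_measurable (~` A).
Proof. exact: sigma_algebraC. Qed.

Let matrix_measurable_bigcup (F : (set 'M[T]_(m, n))^nat) :
  (forall i, matrix_measurable (F i)) -> matrix_measurable (\bigcup_i F i).
Proof. exact: sigma_algebra_bigcup. Qed.

HB.instance Definition _ := @isMeasurable.Build (matrix_display d)
  'M[T]_(m, n) matrix_measurable
  matrix_measurable0 matrix_measurableC matrix_measurable_bigcup.

End measurable_matrix.

Section norms.
Context {R : realType}.

Definition euclidean_norm n (x : 'cV[R]_n) : R :=
  Num.sqrt (\sum_(i < n) x i 0 ^+ 2).

Definition spectral_norm m n (A : 'M[R]_(m, n)) : R :=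
  sup [set euclidean_norm (A *m x) | x in [set x | euclidean_norm x <= 1]].

Definition frobenius_dot m n (X Y : 'M[R]_(m, n)) : R :=
  \sum_(i < m) \sum_(j < n) X i j * Y i j.

Definition frobenius_norm m n (X : 'M[R]_(m, n)) : R :=
  Num.sqrt (frobenius_dot X X).

Definition subdifferential m n (f : 'M[R]_(m, n) -> R) (X : 'M[R]_(m, n)) :
    set 'M[R]_(m, n) :=
  [set g | forall Y, f X + frobenius_dot g (Y - X) <= f Y].

End norms.

Section probability_notions.
Context d (T : measurableType d) (R : realType) (P : probability T R).
Local Open Scope ereal_scope.

(* The infimum is taken in \bar R, so that it is +oo when no s is admissible. *)
Definition psi2_norm (X : T -> R) : \bar R :=
  ereal_inf [set s%:E | s in
    [set s : R | (0 < s)%R /\ 'E_P[fun x => expR (X x ^+ 2 / s ^+ 2)] <= 2%:E]].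

(* Y is a version of the conditional expectation E[Z | F], for F a
   sub-sigma-algebra and Z nonnegative, possibly with infinite expectation. *)
Definition is_cond_expectation (F : set (set T)) (Z Y : T -> \bar R) : Prop :=
  [/\ forall x, 0 <= Y x,
      forall B : set \bar R, measurable B -> F (Y @^-1` B) &
      forall E, F E -> \int[P]_(x in E) Y x = \int[P]_(x in E) Z x].

Definition cond_psi2_norm_le (F : set (set T)) (X : T -> R) (eta : R) : Prop :=
  exists2 Y : T -> \bar R,
    is_cond_expectation F (fun x => (expR (X x ^+ 2 / eta ^+ 2))%:E) Y &
    {ae P, forall x, Y x <= 2%:E}.

Definition mutually_independent (I : choiceType) (F : I -> set (set T)) :
    Prop :=
  forall (J : {fset I}) (E : I -> set T),
    (forall i, i \in J -> F i (E i)) ->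
    P (\bigcap_(i in [set` J]) E i) = \prod_(i <- J) P (E i).

End probability_notions.

(* The law N(0, sigma^2 I_m) is the product of m copies of N(0, sigma^2), hence
   determined by its values on measurable boxes; the second argument of
   normal_prob is the standard deviation. *)
Definition is_isotropic_gaussian (R : realType) m (sigma : R)
    (mu : set 'cV[R]_m -> \bar R) : Prop :=
  forall A : 'I_m -> set R, (forall i, measurable (A i)) ->
    mu [set v | forall i, A i (v i 0)] =
    (\prod_(i < m) normal_prob 0 sigma (A i))%E.

Section sigma_algebras.
Context d (T : measurableType d).

Definition sigma_family (I : Type) d' (T' : measurableType d') (D : set I)
    (X : I -> T -> T') : set (set T) :=
  <<s \bigcup_(i in D) g_sigma_algebra_preimage (X i) >>.

(* sigma(x0, w_0, ..., w_(t-1)) *)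
Definition attack_filtration d' (X : measurableType d')
    (x0 : T -> X) (w : nat -> T -> X) (t : nat) : set (set T) :=
  <<s g_sigma_algebra_preimage x0 `|`
      \bigcup_(s in `I_t) g_sigma_algebra_preimage (w s) >>.

(* sigma(x0, w_0, ..., w_(t-1), u_0, ..., u_(t-1)) *)
Definition history d' d'' (X : measurableType d') (U : measurableType d'')
    (x0 : T -> X) (w : nat -> T -> X) (u : nat -> T -> U) (t : nat) :
    set (set T) :=
  <<s g_sigma_algebra_preimage x0 `|`
      \bigcup_(s in `I_t) g_sigma_algebra_preimage (w s) `|`
      \bigcup_(s in `I_t) g_sigma_algebra_preimage (u s) >>.

End sigma_algebras.

Section system.
Context {R : realType} (n m r : nat).

(* [D, C B, C A B, ..., C A^(k-2) B], in k blocks of width m; the index type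
   \sum_(j < k) m has cardinality m * k. *)
Definition markov_matrix (A : 'M[R]_n) (B : 'M[R]_(n, m)) (C : 'M[R]_(r, n))
    (D : 'M[R]_(r, m)) (k : nat) : 'M[R]_(r, \sum_(j < k) m) :=
  \mxrow_(j < k)
    (if val j is j'.+1 then C *m (A ^+ j') *m B else D).

(* [u_t; u_(t-1); ...; u_(t-k+1)], meant for k <= t.+1: the subtraction below
   is truncated. *)
Definition stacked_input (k : nat) (u : nat -> 'cV[R]_m) (t : nat) :
    'cV[R]_(\sum_(j < k) m) :=
  \mxcol_(j < k) u (t - j)%N.

End system.

(* Main.v *)
(* Let [E = G^(t) - G*], [U = U_{t+k-1}], [X = <g, E>] and let [att] be the
   event that some attack hits the window, of probability [q]. The best step
   size gives [|E+|^2 <= |E|^2 - (2 alpha - alpha^2) X^2 / |g|^2], the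
   subgradient inequality and the triangle inequality give
   [X >= |E U| (1 - 2 1_att) - 2 |C A^(k-1) x_t|] and [|g| <= |U|]. Instead of
   taking conditional expectations in the quotient, linearize it:
   [X^2 / |g|^2 >= 2 lam X - lam^2 |U|^2] with [lam] proportional to [|E|],
   which is determined by the history. As [att], [U] and the history are
   independent, the expectation of [|E| |E U| (1 - 2 1_att)] is [1 - 2q] times
   that of [|E| |E U|], and that of [|E|^2 |U|^2] is [mk sigma^2 |E|^2]. The
   sharp constant in [E |a . u| = sqrt (2 / pi) sigma |a|] is not needed: the
   second and fourth Gaussian moments yield the constant [9/16], and after
   [|C A^(k-1) x_t|] is absorbed, the gain
   [(81/320) (1 - 2q)^2 / (mk) >= (1 - 2q)^2 / (4 mk)], whereas the claimed rate
   is [(1 - 2q)^2 / (2 pi mk)] and [2 pi >= 4]. *)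

Require Import Defs.
From HB Require Import structures.
From mathcomp Require Import all_boot all_order all_algebra.
From mathcomp Require Import finmap.
From mathcomp Require Import all_classical all_reals all_analysis measurable_realfun.
From mathcomp Require Import ring lra zify.

Set Implicit Arguments.
Unset Strict Implicit.
Unset Printing Implicit Defensive.

Import Order.TTheory GRing.Theory Num.Theory.
Import numFieldNormedType.Exports.

Local Open Scope classical_set_scope.
Local Open Scope ring_scope.

(** As [g] and [gamma] are selected from [U] and [y], nothing factors out of [X^2 / |g|^2] under
    conditioning. With a multiplier determined by the history, the terms in [|E U|] and [|U|] become
    a history weight times a moment of fresh inputs, possibly times the attack flag, and Tonelli on
    a product law integrates them out. Hence the moment lemmas carry an arbitrary nonnegative
    weight, and inequalities are arranged with nonnegative integrands on both sides: integrals live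
    in [\bar R] and are subtracted only once known to be finite.

    Even Gaussian moments suffice because a combination of [x^2] and [x^4] bounds [|x|] from below;
    they are computed coordinate by coordinate from one-dimensional integrals.

    The state [x_t] may be correlated with [E] in any way, the attacks being adversarial, so the
    cross term is split by Young's inequality and only the second moment of [x_t] enters, bounded
    uniformly in [t] by a geometric sum. The noise of one window is the contraction rate times a
    fixed level, the factor [(1 - 2q)^2] of the rate cancelling the one in [nu^2]: that level is the
    fixed point of the recursion, and [K] depends on [psi] alone. *)

Local Ltac nonneg := repeat first
  [done | exact: sqr_ge0 | exact: exprn_even_ge0 | apply: mulr_ge0 | apply: addr_ge0].

(** * Moments of the normal distribution *)

Section normal_moments.
Context {R : realType} (s : R).
Hypothesis s_gt0 : 0 < s.
Local Notation mu := (@lebesgue_measure R).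
Local Notation phi := (normal_pdf 0 s).

(** The change of variables goes through the Radon-Nikodym derivative, which agrees with [phi]
    almost everywhere because both have the same integral over every measurable set. *)
Lemma ge0_integral_normal_prob (f : R -> \bar R) :
  (forall x, 0 <= f x)%E -> measurable_fun setT f ->
  (\int[normal_prob 0 s]_x f x = \int[mu]_x (f x * (phi x)%:E))%E.
Proof.
move=> f0 mf; have dom := @normal_prob_dominates R 0 s.
rewrite -(Radon_Nikodym_SigmaFinite.change_of_variables dom f0)//.
apply: ae_eq_integral => //.
- apply: emeasurable_funM => //.
  exact: measurable_int (Radon_Nikodym_SigmaFinite.f_integrable dom).
- apply: emeasurable_funM => //; apply/measurable_EFinP.
  exact: measurable_normal_pdf.
- apply: ae_eqe_mul2l => /=; apply: integral_ae_eq => //=.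
  + exact: Radon_Nikodym_SigmaFinite.f_integrable.
  + by apply/measurable_EFinP; exact: measurable_normal_pdf.
  + by move=> E _ mE; rewrite -Radon_Nikodym_SigmaFinite.f_integral.
Qed.

Lemma normal_pdf_centeredE (x : R) :
  phi x = normal_peak s * expR (- (x ^+ 2 / (s ^+ 2 *+ 2))).
Proof. by rewrite normal_pdfE ?gt_eqF// /normal_fun subr0 mulNr. Qed.

Lemma is_derive_normal_pdf (x : R) :
  is_derive x 1 phi (- (x / s ^+ 2) * phi x).
Proof.
rewrite (funext normal_pdf_centeredE).
apply: is_derive_eq; rewrite /GRing.scale /=.
by field; rewrite gt_eqF.
Qed.

Lemma normal_pdf_even (x : R) : phi (- x) = phi x.
Proof.
by rewrite !normal_pdf_centeredE sqrrN.
Qed.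

(** With [y = x^2 / (2 s^2)], the exponential series gives [y^(j+1) <= (j+1)! e^y]; since
    [x^(j+1) <= x^(2(j+1))] for [x >= 1], it follows that [x^j phi(x) <= c / x]. *)
Lemma cvg_expr_normal_pdf j :
  (x ^+ j * phi x) @[x --> +oo%R] --> (0 : R).
Proof.
pose c := normal_peak s * ((s ^+ 2 *+ 2) ^+ j.+1 * (j.+1)`!%:R).
have c0 : 0 <= c.
  by rewrite !mulr_ge0 ?normal_peak_ge0// exprn_ge0// mulrn_wge0// sqr_ge0.
have cV : (c * x^-1) @[x --> +oo%R] --> (0 : R).
  rewrite -[X in _ --> X](mulr0 c); apply: cvgMr.
  by apply/gtr0_cvgV0; [exact: nbhs_pinfty_gt|exact: cvg_id].
apply: (@squeeze_cvgr _ _ _ _ (cst 0) (fun x => c * x^-1)) => //; last first.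
  exact: cvg_cst.
near=> x.
have x1 : 1 <= x by near: x; exact: nbhs_pinfty_ge.
have x0 : 0 < x by exact: lt_le_trans x1.
rewrite mulr_ge0 ?normal_pdf_ge0 ?exprn_ge0 ?(ltW x0)//=.
rewrite normal_pdf_centeredE expRN.
set y := x ^+ 2 / _; have y0 : 0 <= y by rewrite divr_ge0 ?sqr_ge0// mulrn_wge0 ?sqr_ge0.
have key : y ^+ j.+1 <= (j.+1)`!%:R * expR y.
  rewrite mulrC -ler_pdivrMr ?ltr0n ?fact_gt0//.
  by apply: le_trans (expR_ge1Dxn j y0); rewrite lerDr.
have yE : x ^+ 2 = (s ^+ 2 *+ 2) * y.
  by rewrite /y mulrC divfK// mulrn_eq0/= sqrf_eq0 gt_eqF.
rewrite ler_pdivlMr// /c mulrA mulrAC -mulrA mulrAC.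
rewrite [leLHS]mulrC ler_wpM2l ?normal_peak_ge0// mulrA -exprSr.
rewrite ler_pdivrMr ?expR_gt0// -mulrA.
apply: (@le_trans _ _ ((x ^+ 2) ^+ j.+1)).
  by rewrite -exprM ler_weXn2l// leq_pmull.
rewrite yE exprMn ler_wpM2l// exprn_ge0// mulrn_wge0// sqr_ge0.
Unshelve. all: by end_near. Qed.

Lemma continuous_expr_normal_pdf j : continuous (fun x : R => x ^+ j * phi x).
Proof.
move=> x; apply: cvgM; first exact: exprn_continuous.
by apply: continuous_normal_pdf; rewrite gt_eqF.
Qed.

Let measurable_expr_normal_pdf j (D : set R) : measurable D ->
  measurable_fun D (fun x : R => (x ^+ j * phi x)%:E).
Proof.
move=> mD; apply/measurable_EFinP/measurable_funTS.
by apply: continuous_measurable_fun; exact: continuous_expr_normal_pdf.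
Qed.

(* The antiderivative [G] of [(a s^2 - x^2) x^j phi] is monotone on either side
   of [c = sqrt a * s], so each half of the line only involves nonnegative
   integrands. *)
Lemma integral0y_expr_normal_pdf j :
  (\int[mu]_(x in `[0%R, +oo[) (x ^+ j.+2 * phi x)%:E =
   (j.+1%:R * s ^+ 2)%:E * \int[mu]_(x in `[0%R, +oo[) (x ^+ j * phi x)%:E)%E.
Proof.
set a : R := j.+1%:R; pose c := Num.sqrt a * s.
have a0 : 0 < a by rewrite ltr0n.
have c0 : 0 < c by rewrite mulr_gt0// sqrtr_gt0.
have c2 : c ^+ 2 = a * s ^+ 2 by rewrite exprMn sqr_sqrtr// ltW.
pose G (x : R) := s ^+ 2 * (x ^+ j.+1 * phi x).
pose g (x : R) := a * s ^+ 2 * (x ^+ j * phi x) - x ^+ j.+2 * phi x.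
have dG (x : R) : is_derive x 1 G (g x).
  have := is_derive_normal_pdf x => dphi.
  have dX := is_deriveZ (s ^+ 2) (is_deriveM (is_deriveX j.+1 (is_derive_id x (1 : R))) dphi).
  have <- : s ^+ 2 \*: ((@id R) ^+ j.+1 * phi) = G.
    by apply/funext => y; rewrite /G !fctE.
  apply: (is_derive_eq dX); rewrite !fctE /GRing.scale /= /g /a !exprS.
  by field; rewrite gt_eqF.
have cG : continuous G.
  by move=> x; apply/differentiable_continuous/derivable1_diffP.
have cg : continuous g.
  move=> x; apply: cvgB; last exact: continuous_expr_normal_pdf.
  by apply: cvgM; [exact: cvg_cst|exact: continuous_expr_normal_pdf].
have GE : (G^`())%classic =1 g by move=> x; rewrite derive1E derive_val.
have gE (x : R) : g x = (c ^+ 2 - x ^+ 2) * (x ^+ j * phi x).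
  by rewrite /g c2 !exprS; ring.
have left_part : (\int[mu]_(x in `[0%R, c]) (g x)%:E = (G c)%:E)%E.
  rewrite (@continuous_FTC2 _ g G)//.
  - by rewrite /G expr0n/= mul0r mulr0 sube0.
  - exact: continuous_subspaceT.
  - split; first by move=> x _.
      by apply: cvg_at_right_filter; exact: cG.
    by apply: cvg_at_left_filter; exact: cG.
(* [G] vanishes at 0 and at infinity, so both halves produce the same number [G c]. In [left_eq] and
   [right_eq] it is added on opposite sides, so it cancels without any subtraction of integrals. *)
have right_part : (\int[mu]_(x in `[c, +oo[) (- g x)%:E = (G c)%:E)%E.
  rewrite (@ge0_continuous_FTC2y _ (\- g) (\- G) c 0)//.
  - by rewrite -EFinB; congr EFin; rewrite sub0r; exact: opprK.
  - move=> x cx; rewrite /= gE -mulNr opprB mulr_ge0//.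
      by rewrite subr_ge0 ler_sqr ?nnegrE ?(le_trans _ cx)// ltW.
    by rewrite mulr_ge0 ?normal_pdf_ge0// exprn_ge0// (le_trans _ cx)// ltW.
  - by apply: continuous_subspaceT => x; apply: cvgN; exact: cg.
  - rewrite -oppr0; apply: cvgN; rewrite -[X in _ --> X](mulr0 (s ^+ 2)).
    by apply: cvgMr; exact: cvg_expr_normal_pdf.
  - by apply: cvgN; apply: cvg_at_right_filter; exact: cG.
  - by move=> x _; rewrite derive1E deriveN// -derive1E GE.
have split_int (h : R -> R) : continuous h -> (forall x, 0 <= x -> 0 <= h x) ->
    (\int[mu]_(x in `[0%R, +oo[) (h x)%:E =
     \int[mu]_(x in `[0%R, c]) (h x)%:E + \int[mu]_(x in `[c, +oo[) (h x)%:E)%E.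
  move=> ch h0.
  have mh D : measurable D -> measurable_fun D (fun x => (h x)%:E).
    move=> mD; apply/measurable_EFinP/measurable_funTS.
    exact: continuous_measurable_fun.
  rewrite -[in RHS]integral_itv_bndo_bndc//; last exact: mh.
  rewrite -ge0_integral_setU//=; last 3 first.
  - by apply: mh; exact: measurableU.
  - move=> x []/=; rewrite in_itv/= => /andP[cx _]; rewrite lee_fin h0//.
    by rewrite (le_trans _ cx)// ltW.
  - apply/disj_setPS => x/= []; rewrite !in_itv/= => /andP[_ xc].
    by rewrite leNgt xc.
  - by rewrite -(@itv_bndbnd_setU _ _ _ (BLeft c))//= bnd_simp ltW.
have h_ge0 i (x : R) : 0 <= x -> 0 <= x ^+ i * phi x.
  by move=> x0; rewrite mulr_ge0 ?normal_pdf_ge0// exprn_ge0.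
have cs i := @continuous_expr_normal_pdf i.
have mi i D : measurable D -> measurable_fun D (fun x : R => (x ^+ i * phi x)%:E).
  exact: measurable_expr_normal_pdf.
have mg D : measurable D -> measurable_fun D (fun x => (g x)%:E).
  by move=> mD; apply/measurable_EFinP/measurable_funTS; exact: continuous_measurable_fun.
have as0 : 0 <= a * s ^+ 2 by rewrite mulr_ge0 ?sqr_ge0// ltW.
have left_eq : ((a * s ^+ 2)%:E * \int[mu]_(x in `[0%R, c]) (x ^+ j * phi x)%:E =
    \int[mu]_(x in `[0%R, c]) (x ^+ j.+2 * phi x)%:E + (G c)%:E)%E.
  rewrite -left_part -ge0_integralZl//=; last 2 first.
  - exact: mi.
  - by move=> x; rewrite in_itv/= => /andP[x0 _]; rewrite lee_fin h_ge0.
  rewrite -ge0_integralD//=; last 4 first.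
  - by move=> x; rewrite in_itv/= => /andP[x0 _]; rewrite lee_fin h_ge0.
  - exact: mi.
  - move=> x; rewrite in_itv/= => /andP[x0 xc]; rewrite lee_fin gE mulr_ge0 ?h_ge0//.
    by rewrite subr_ge0 ler_sqr ?nnegrE// ltW.
  - exact: mg.
  by apply: eq_integral => x _; rewrite -EFinM -EFinD /g addrC subrK.
have right_eq : (\int[mu]_(x in `[c, +oo[) (x ^+ j.+2 * phi x)%:E =
    (a * s ^+ 2)%:E * \int[mu]_(x in `[c, +oo[) (x ^+ j * phi x)%:E + (G c)%:E)%E.
  have xpos (x : R) : x \in `[c, +oo[ -> 0 <= x.
    by rewrite in_itv/= andbT => /(le_trans (ltW c0)).
  rewrite -right_part -ge0_integralZl//=; last 2 first.
  - exact: mi.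
  - by move=> x /xpos x0; rewrite lee_fin h_ge0.
  rewrite -ge0_integralD//=; last 4 first.
  - by move=> x /xpos x0; rewrite -EFinM lee_fin mulr_ge0 ?h_ge0.
  - by apply: measurable_funeM; exact: mi.
  - move=> x xc; have x0 := xpos _ xc.
    rewrite lee_fin gE -mulNr opprB mulr_ge0 ?h_ge0//.
    rewrite subr_ge0 ler_sqr ?nnegrE// ?(ltW c0)//.
    by move: xc; rewrite in_itv/= andbT.
  - apply/measurable_EFinP; apply: measurableT_comp => //.
    by apply/measurable_EFinP; exact: mg.
  by apply: eq_integral => x _; rewrite -EFinM -EFinD /g opprB addrCA subrr addr0.
rewrite split_int//; last by move=> x; exact: h_ge0.
rewrite [in RHS]split_int//; last by move=> x; exact: h_ge0.
rewrite ge0_muleDr//; last 2 first.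
- by apply: integral_ge0 => x; rewrite /= in_itv/= => /andP[x0 _]; rewrite lee_fin h_ge0.
- apply: integral_ge0 => x; rewrite /= in_itv/= andbT => cx.
  by rewrite lee_fin h_ge0// (le_trans _ cx)// ltW.
by rewrite left_eq right_eq addeA addeAC.
Qed.

Lemma integral0y_normal_pdf :
  (\int[mu]_(x in `[0%R, +oo[) (phi x)%:E = (2^-1)%:E)%E.
Proof.
have := integral_normal_pdf 0 s.
rewrite ge0_symfun_integralT//; last 3 first.
- by move=> x; exact: normal_pdf_ge0.
- by apply: continuous_normal_pdf; rewrite gt_eqF.
- by move=> x; rewrite /= normal_pdf_even.
have -> : [set x : R | 0 <= x] = `[0, +oo[%classic.
  by apply/seteqP; split => x /=; rewrite in_itv/= andbT.
move=> I2; have : (2^-1%:E * (2%:E * \int[mu]_(x in `[0%R, +oo[) (phi x)%:E) =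
  2^-1%:E)%E by rewrite I2 mule1.
by rewrite muleA -EFinM mulVf// mul1e.
Qed.

(** Folding the line onto the half-line makes the odd powers cancel pointwise in [h x + h (- x)], so
    the mixed terms of a power of [b + a x] disappear while every integrand stays nonnegative. *)
Lemma integral_normal_prob_symmetrized (h : R -> R) :
  continuous h -> (forall x, 0 <= h x) ->
  (\int[normal_prob 0 s]_x (h x)%:E =
   \int[mu]_(x in `[0%R, +oo[) ((h x + h (- x)) * phi x)%:E)%E.
Proof.
move=> ch h0.
have chphi : continuous (fun x => h x * phi x).
  by move=> x; apply: cvgM; [exact: ch|apply: continuous_normal_pdf; rewrite gt_eqF].
have hphi0 x : 0 <= h x * phi x by rewrite mulr_ge0// normal_pdf_ge0.
have mhphi D : measurable D -> measurable_fun D (fun x => (h x * phi x)%:E).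
  move=> mD; apply/measurable_EFinP/measurable_funTS.
  exact: continuous_measurable_fun.
rewrite ge0_integral_normal_prob//; last first.
  by apply/measurable_EFinP; exact: continuous_measurable_fun.
under eq_integral do rewrite -EFinM.
rewrite -(set_itvNyy R) (@itv_bndbnd_setU _ _ _ (BLeft 0))//.
rewrite ge0_integral_setU//=; last 3 first.
- by apply: mhphi; exact: measurableU.
- by move=> x _; rewrite lee_fin.
- apply/disj_setPS => x/= []; rewrite !in_itv/= andbT => x0.
  by rewrite leNgt x0.
rewrite integral_itv_bndo_bndc//; last exact: mhphi.
have := @ge0_integration_by_substitutionNy R (fun x => h x * phi x) 0.
rewrite oppr0 => ->; [|exact: continuous_subspaceT|by move=> x _].
rewrite -ge0_integralD//=; last 4 first.
- by move=> x _; rewrite lee_fin.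
- apply/measurable_EFinP/measurable_funTS.
  apply: (@measurableT_comp _ _ _ _ _ _ (fun x : R => h x * phi x)) => //.
  exact: continuous_measurable_fun.
- by move=> x _; rewrite lee_fin.
- exact: mhphi.
by apply: eq_integral => x _; rewrite -EFinD normal_pdf_even mulrDl addrC.
Qed.

Let integral0y_even_quartic (c0 c2 c4 : R) : 0 <= c0 -> 0 <= c2 -> 0 <= c4 ->
  (\int[mu]_(x in `[0%R, +oo[)
     (2 * (c0 + c2 * x ^+ 2 + c4 * x ^+ 4) * phi x)%:E =
   (c0 + c2 * s ^+ 2 + 3 * c4 * s ^+ 4)%:E)%E.
Proof.
move=> c0_ge0 c2_ge0 c4_ge0.
have M0 : (\int[mu]_(x in `[0%R, +oo[) (x ^+ 0 * phi x)%:E = (2^-1)%:E)%E.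
  by rewrite -integral0y_normal_pdf; apply: eq_integral => x _; rewrite expr0 mul1r.
have M2 := integral0y_expr_normal_pdf 0; rewrite M0 -EFinM in M2.
have M4 := integral0y_expr_normal_pdf 2; rewrite M2 -EFinM in M4.
have mi i : measurable_fun (`[0%R, +oo[%classic : set R)
    (fun x : R => (x ^+ i * phi x)%:E).
  exact: measurable_expr_normal_pdf.
have i0 i (x : R) : (`[0%R, +oo[%classic : set R) x -> (0 <= (x ^+ i * phi x)%:E)%E.
  rewrite /= in_itv/= andbT => x0.
  by rewrite lee_fin mulr_ge0 ?normal_pdf_ge0// exprn_ge0.
have mZ c i : 0 <= c -> measurable_fun (`[0%R, +oo[%classic : set R)
    (fun x : R => (c%:E * (x ^+ i * phi x)%:E)%E).
  by move=> _; apply: measurable_funeM; exact: mi.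
have Z0 c i (x : R) : 0 <= c -> (`[0%R, +oo[%classic : set R) x ->
    (0 <= c%:E * (x ^+ i * phi x)%:E)%E.
  by move=> cp x0; rewrite mule_ge0 ?lee_fin//; exact: i0.
have cc0 : 0 <= 2 * c0 by rewrite mulr_ge0.
have cc2 : 0 <= 2 * c2 by rewrite mulr_ge0.
have cc4 : 0 <= 2 * c4 by rewrite mulr_ge0.
transitivity (\int[mu]_(x in `[0%R, +oo[)
   ((2 * c0)%:E * (x ^+ 0 * phi x)%:E + (2 * c2)%:E * (x ^+ 2 * phi x)%:E
    + (2 * c4)%:E * (x ^+ 4 * phi x)%:E))%E.
  by apply: eq_integral => x _; rewrite -!EFinM -!EFinD; congr EFin; ring.
rewrite ge0_integralD//=; last 4 first.
- by move=> x x0; rewrite adde_ge0// Z0.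
- by apply: emeasurable_funD; exact: mZ.
- by move=> x x0; exact: Z0.
- exact: mZ.
rewrite ge0_integralD//=; last 4 first.
- by move=> x x0; exact: Z0.
- exact: mZ.
- by move=> x x0; exact: Z0.
- exact: mZ.
rewrite !ge0_integralZl//=; try exact: mi; try exact: i0.
by rewrite M0 M2 M4 -!EFinM -!EFinD; congr EFin; field.
Qed.

Lemma integral_normal_prob_sqr (a b : R) :
  (\int[normal_prob 0 s]_x ((b + a * x) ^+ 2)%:E =
   (b ^+ 2 + a ^+ 2 * s ^+ 2)%:E)%E.
Proof.
rewrite integral_normal_prob_symmetrized; last 2 first.
- move=> x; apply: (@continuous_comp _ _ _ (fun x => b + a * x) (fun x => x ^+ 2)).
    by apply: cvgD; [exact: cvg_cst|apply: cvgM; [exact: cvg_cst|exact: cvg_id]].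
  exact: exprn_continuous.
- by move=> x; rewrite sqr_ge0.
have := @integral0y_even_quartic (b ^+ 2) (a ^+ 2) 0.
rewrite !sqr_ge0 mulr0 mul0r addr0 => <-//.
by apply: eq_integral => x _; congr EFin; ring.
Qed.

Lemma integral_normal_prob_expr4 (a b : R) :
  (\int[normal_prob 0 s]_x ((b + a * x) ^+ 4)%:E =
   (b ^+ 4 + 6 * b ^+ 2 * a ^+ 2 * s ^+ 2 + 3 * a ^+ 4 * s ^+ 4)%:E)%E.
Proof.
rewrite integral_normal_prob_symmetrized; last 2 first.
- move=> x; apply: (@continuous_comp _ _ _ (fun x => b + a * x) (fun x => x ^+ 4)).
    by apply: cvgD; [exact: cvg_cst|apply: cvgM; [exact: cvg_cst|exact: cvg_id]].
  exact: exprn_continuous.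
- by move=> x; rewrite exprn_even_ge0.
have b4_ge0 : 0 <= b ^+ 4 by rewrite exprn_even_ge0.
have a4_ge0 : 0 <= a ^+ 4 by rewrite exprn_even_ge0.
have ab_ge0 : 0 <= 6 * b ^+ 2 * a ^+ 2.
  by apply: mulr_ge0; [apply: mulr_ge0|]; rewrite ?sqr_ge0.
rewrite -integral0y_even_quartic//.
by apply: eq_integral => x _; congr EFin; ring.
Qed.

End normal_moments.

(** * Independence *)

Section independence.
Context d (T : measurableType d) (R : realType) (P : probability T R).
Variable F : set (set T).
Hypothesis F_measurable : F `<=` measurable.
Local Notation S := (g_sigma_algebraType F).
Local Open Scope ereal_scope.

Lemma g_sigma_algebra_measurable : <<s F >> `<=` @measurable _ T.
Proof. by apply: smallest_sub => //; exact: sigma_algebra_measurable. Qed.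

Lemma measurable_fun_g_sigma_algebraW d' (Y : measurableType d') (f : S -> Y) :
  measurable_fun setT f -> measurable_fun setT (f : T -> Y).
Proof.
move=> mf _ B mB; apply: g_sigma_algebra_measurable.
exact: (mf measurableT).
Qed.

(** For fixed [B], the finite measures sending [A] to [P (A]&[B)] and to [P A * P B] agree on the
    pi-system [F], hence on the sigma-algebra it generates. *)
Lemma g_sigma_algebra_independent (B : set T) : setI_closed F -> F setT ->
  measurable B -> (forall A, F A -> P (A `&` B) = P A * P B) ->
  forall A, <<s F >> A -> P (A `&` B) = P A * P B.
Proof.
move=> FI FT mB FB A sA.
have PBE : P B = (fine (P B))%:E by rewrite fineK// fin_num_measure.
have PB0 : (0 <= fine (P B))%R by exact: fine_ge0.
have -> : P A * P B = mscale (NngNum PB0) P A by rewrite /mscale/= muleC -PBE.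
have -> : P (A `&` B) = mrestr P mB A by [].
apply: (@g_sigma_algebra_measure_unique _ _ _ F _ (fun=> setT)) => //.
- exact: bigcup_const.
- move=> C FC; transitivity (P C * P B); first exact: FB.
  by rewrite /= /mscale/= muleC -PBE.
- move=> _; rewrite /= /mrestr setTI.
  by rewrite (le_lt_trans (probability_le1 _ _)) ?ltry.
Qed.

(* Conditionally on [<<s F >>], the independent variable [v] may be integrated
   out with its first argument frozen. *)
Lemma freezing d' (Y : measurableType d') (N : probability Y R) (v : T -> Y)
    (h : S * Y -> \bar R) :
  measurable_fun setT v ->
  (forall A B, <<s F >> A -> measurable B -> P (A `&` v @^-1` B) = P A * N B) ->
  measurable_fun setT h -> (forall z, 0 <= h z) ->
  \int[P]_om h (om, v om) = \int[P]_om \int[N]_z h (om, z).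
Proof.
move=> mv indep mh h0.
have mid : measurable_fun setT (id : T -> S).
  move=> _ B mB; rewrite setTI; exact: g_sigma_algebra_measurable.
have mpair : measurable_fun setT (fun om => (om, v om) : S * Y).
  exact: measurable_fun_pair.
pose idm : {mfun T >-> S} := HB.pack (id : T -> S) (isMeasurableFun.Build _ _ _ _ _ mid).
pose pairm : {mfun T >-> (S * Y)%type} := HB.pack (fun om => (om, v om) : S * Y)
  (isMeasurableFun.Build _ _ _ _ _ mpair).
(* As a random variable with values in [S], the identity carries all the information in [<<s F >>].
   Independence says that the law of the pair [(id, v)] agrees with the product law on rectangles,
   hence everywhere; Tonelli then gives the iterated integral. *)
have prodE (X : set (S * Y)) : measurable X ->
    (distribution P idm \x N) X = distribution P pairm X.
  by apply: product_measure_unique => A B mA mB; rewrite /distribution/= -indep.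
transitivity (\int[distribution P pairm]_z h z).
  by rewrite ge0_integral_pushforward//= => z _.
transitivity (\int[distribution P idm \x N]_z h z).
  by apply: eq_measure_integral => X mX _; exact/esym/prodE.
rewrite fubini_tonelli1// ge0_integral_pushforward//=.
  exact: measurable_fun_fubini_tonelli_F.
by move=> z _; exact: integral_ge0.
Qed.

End independence.

Lemma measurable_fun_g_sigma_algebra_sub (T : pointedType) (F G : set (set T))
    d (Y : measurableType d) (f : T -> Y) : F `<=` <<s G >> ->
  measurable_fun setT (f : g_sigma_algebraType F -> Y) ->
  measurable_fun setT (f : g_sigma_algebraType G -> Y).
Proof.
move=> FG mf _ B mB; suff sub : <<s F >> `<=` <<s G >>.
  by apply: sub; exact: (mf measurableT).
by apply: smallest_sub => //; exact: smallest_sigma_algebra.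
Qed.

(** Freezing [Y] leaves an inner integral of the indicator alone, which is the probability of
    [true]. Independence is asked on the generating pi-system only, where it can be checked on
    boxes. *)
Lemma independent_bool_expectation d (T : measurableType d) (R : realType)
    (P : probability T R) (F : set (set T)) (v : {mfun T >-> bool})
    (Y : g_sigma_algebraType F -> R) :
  F `<=` measurable -> setI_closed F -> F setT ->
  (forall A B, F A -> P (A `&` v @^-1` B) = P A * P (v @^-1` B))%E ->
  measurable_fun setT Y -> (forall om, 0 <= Y om) ->
  (\int[P]_om (Y om * (v om)%:R)%:E =
   P (v @^-1` [set true]) * \int[P]_om (Y om)%:E)%E.
Proof.
move=> Fm FI FT indep mY Y0.
pose h (z : g_sigma_algebraType F * bool) : \bar R := (Y z.1 * z.2%:R)%:E.
have mh : measurable_fun setT h.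
  apply/measurable_EFinP; apply: measurable_funM.
    exact: measurableT_comp.
  by apply: (@measurableT_comp _ _ _ _ _ _ (fun b : bool => b%:R : R)).
have h0 z : (0 <= h z)%E by rewrite lee_fin mulr_ge0.
transitivity (\int[P]_om h (om, v om))%E; first by [].
rewrite (@freezing _ _ _ P F Fm _ _ (distribution P v))//; last first.
  move=> A B sA _; apply: (@g_sigma_algebra_independent _ _ _ P F) => //.
    by rewrite -[X in measurable X]setTI; exact: measurable_funP.
  by move=> C FC; exact: indep.
rewrite -ge0_integralZl//=; last first.
- by move=> z _; rewrite lee_fin.
- apply/measurable_EFinP; exact: (measurable_fun_g_sigma_algebraW Fm mY).
apply: eq_integral => om _.
under eq_integral do rewrite /h/= EFinM.
rewrite ge0_integralZl//=; last first.
- by rewrite lee_fin.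
rewrite muleC; congr (_ * _)%E.
rewrite ge0_integral_pushforward//=.
transitivity (\int[P]_x (\1_(v @^-1` [set true]) x)%:E)%E.
  apply: eq_integral => x _; rewrite indicE; congr ((nat_of_bool _)%:R)%:E.
  by apply/idP/idP => [vx|/set_mem//]; exact/mem_set.
rewrite integral_indic//= ?setIT//.
by rewrite -[X in measurable X]setTI; exact: measurable_funP.
Qed.

(** * Matrix norms *)

Section matrix_norms.
Context {R : realType}.

(** The sum of the squares [(Y x_i - S y_i)^2] equals [Y (X Y - S^2)], which settles the case
    [Y > 0]; if [Y = 0], all [y_i] vanish. *)
Lemma cauchy_schwarz (I : finType) (x y : I -> R) :
  (\sum_i x i * y i) ^+ 2 <= (\sum_i x i ^+ 2) * (\sum_i y i ^+ 2).
Proof.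
set S := \sum_i x i * y i; set X := \sum_i x i ^+ 2; set Y := \sum_i y i ^+ 2.
have Y0 : 0 <= Y by apply: sumr_ge0 => i _; exact: sqr_ge0.
have key : 0 <= Y * (X * Y - S ^+ 2).
  have <- : \sum_i (Y * x i - S * y i) ^+ 2 = Y * (X * Y - S ^+ 2).
    transitivity (\sum_i (Y ^+ 2 * x i ^+ 2 - 2 * Y * S * (x i * y i) + S ^+ 2 * y i ^+ 2)).
      by apply: eq_bigr => i _; ring.
    rewrite big_split sumrB/= -!mulr_sumr -/X -/S -/Y; ring.
  by apply: sumr_ge0 => i _; exact: sqr_ge0.
have [Y_eq0|Y_neq0] := eqVneq Y 0.
  have y0 i : y i = 0.
    apply/eqP; rewrite -sqrf_eq0.
    have /eqP := Y_eq0.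
    by rewrite psumr_eq0 => [/allP/(_ i (mem_index_enum _))|? _]; rewrite ?sqr_ge0.
  by rewrite /S big1 ?expr0n ?Y_eq0 ?mulr0// => i _; rewrite y0 mulr0.
by move: key; rewrite pmulr_rge0 ?subr_ge0// lt_neqAle eq_sym Y_neq0.
Qed.

Lemma euclidean_norm_ge0 n (x : 'cV[R]_n) : 0 <= euclidean_norm x.
Proof. exact: sqrtr_ge0. Qed.

Lemma sqr_euclidean_norm n (x : 'cV[R]_n) :
  euclidean_norm x ^+ 2 = \sum_i x i 0 ^+ 2.
Proof. by rewrite sqr_sqrtr// sumr_ge0// => i _; exact: sqr_ge0. Qed.

Lemma euclidean_norm0 n : euclidean_norm (0 : 'cV[R]_n) = 0.
Proof.
by rewrite /euclidean_norm big1 ?sqrtr0// => i _; rewrite mxE expr0n.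
Qed.

Lemma euclidean_normZ n (c : R) (x : 'cV[R]_n) :
  euclidean_norm (c *: x) = `|c| * euclidean_norm x.
Proof.
rewrite /euclidean_norm -sqrtr_sqr -sqrtrM ?sqr_ge0// mulr_sumr.
by congr Num.sqrt; apply: eq_bigr => i _; rewrite mxE exprMn.
Qed.

Lemma euclidean_normN n (x : 'cV[R]_n) : euclidean_norm (- x) = euclidean_norm x.
Proof. by rewrite -scaleN1r euclidean_normZ normrN1 mul1r. Qed.

Lemma euclidean_norm_eq0 n (x : 'cV[R]_n) : euclidean_norm x = 0 -> x = 0.
Proof.
move=> x0; apply/matrixP => i j; rewrite ord1 mxE; apply/eqP; rewrite -sqrf_eq0.
have /eqP := sqr_euclidean_norm x; rewrite x0 expr0n/= eq_sym psumr_eq0.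
  by move=> /allP/(_ i (mem_index_enum _)).
by move=> k _; exact: sqr_ge0.
Qed.

Lemma ler_euclidean_normD n (x y : 'cV[R]_n) :
  euclidean_norm (x + y) <= euclidean_norm x + euclidean_norm y.
Proof.
have nn := addr_ge0 (euclidean_norm_ge0 x) (euclidean_norm_ge0 y).
rewrite -ler_sqr ?nnegrE ?euclidean_norm_ge0// sqrrD !sqr_euclidean_norm.
have -> : \sum_i (x + y) i 0 ^+ 2 = \sum_i x i 0 ^+ 2
    + (\sum_i x i 0 * y i 0) *+ 2 + \sum_i y i 0 ^+ 2.
  rewrite -sumrMnl -!big_split/=.
  by apply: eq_bigr => i _; rewrite mxE sqrrD.
rewrite lerD2r lerD2l lerMn2r/=.
apply: le_trans (ler_norm _) _.
rewrite -ler_sqr ?nnegrE ?mulr_ge0 ?euclidean_norm_ge0// real_normK ?num_real//.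
by rewrite exprMn !sqr_euclidean_norm cauchy_schwarz.
Qed.

Lemma frobenius_dotC m n (X Y : 'M[R]_(m, n)) : frobenius_dot X Y = frobenius_dot Y X.
Proof. by apply: eq_bigr => i _; apply: eq_bigr => j _; rewrite mulrC. Qed.

Lemma frobenius_dotDl m n (X Y Z : 'M[R]_(m, n)) :
  frobenius_dot (X + Y) Z = frobenius_dot X Z + frobenius_dot Y Z.
Proof.
rewrite /frobenius_dot -big_split; apply: eq_bigr => i _; rewrite -big_split.
by apply: eq_bigr => j _; rewrite mxE mulrDl.
Qed.

Lemma frobenius_dotZl m n c (X Y : 'M[R]_(m, n)) :
  frobenius_dot (c *: X) Y = c * frobenius_dot X Y.
Proof.
rewrite /frobenius_dot mulr_sumr; apply: eq_bigr => i _; rewrite mulr_sumr.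
by apply: eq_bigr => j _; rewrite mxE mulrA.
Qed.

Lemma frobenius_dotDr m n (X Y Z : 'M[R]_(m, n)) :
  frobenius_dot Z (X + Y) = frobenius_dot Z X + frobenius_dot Z Y.
Proof. by rewrite frobenius_dotC frobenius_dotDl !(frobenius_dotC Z). Qed.

Lemma frobenius_dotZr m n c (X Y : 'M[R]_(m, n)) :
  frobenius_dot X (c *: Y) = c * frobenius_dot X Y.
Proof. by rewrite frobenius_dotC frobenius_dotZl frobenius_dotC. Qed.

Lemma frobenius_dotNl m n (X Y : 'M[R]_(m, n)) :
  frobenius_dot (- X) Y = - frobenius_dot X Y.
Proof. by rewrite -scaleN1r frobenius_dotZl mulN1r. Qed.

Lemma frobenius_dot_ge0 m n (X : 'M[R]_(m, n)) : 0 <= frobenius_dot X X.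
Proof. by do 2![apply: sumr_ge0 => ? _]; rewrite -expr2 sqr_ge0. Qed.

Lemma frobenius_norm_ge0 m n (X : 'M[R]_(m, n)) : 0 <= frobenius_norm X.
Proof. exact: sqrtr_ge0. Qed.

Lemma sqr_frobenius_norm m n (X : 'M[R]_(m, n)) :
  frobenius_norm X ^+ 2 = frobenius_dot X X.
Proof. by rewrite sqr_sqrtr// frobenius_dot_ge0. Qed.

Lemma sqr_frobenius_normDZ m n (X Y : 'M[R]_(m, n)) (c : R) :
  frobenius_norm (X + c *: Y) ^+ 2 =
  frobenius_norm X ^+ 2 + 2 * c * frobenius_dot Y X + c ^+ 2 * frobenius_norm Y ^+ 2.
Proof.
rewrite !sqr_frobenius_norm frobenius_dotDl frobenius_dotZl !frobenius_dotDr.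
by rewrite !frobenius_dotZr (frobenius_dotC X Y); ring.
Qed.

Lemma frobenius_norm_gt0 m n (X : 'M[R]_(m, n)) : X != 0 -> 0 < frobenius_norm X.
Proof.
move=> /matrix0Pn[i [j Xij]]; rewrite sqrtr_gt0 /frobenius_dot.
rewrite (bigD1 i)//= (bigD1 j)//= -addrA ltr_pwDl//.
  by rewrite -expr2 lt_neqAle sqr_ge0 andbT eq_sym sqrf_eq0.
rewrite addr_ge0// ?sumr_ge0// => k _; first by rewrite -expr2 sqr_ge0.
by apply: sumr_ge0 => l _; rewrite -expr2 sqr_ge0.
Qed.

Lemma euclidean_norm_mulmx m n (M : 'M[R]_(m, n)) (x : 'cV[R]_n) :
  euclidean_norm (M *m x) <= frobenius_norm M * euclidean_norm x.
Proof.
rewrite -ler_sqr ?nnegrE ?mulr_ge0 ?euclidean_norm_ge0 ?frobenius_norm_ge0//.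
rewrite exprMn !sqr_euclidean_norm sqr_frobenius_norm mulr_suml.
apply: ler_sum => i _; rewrite mxE; apply: le_trans (cauchy_schwarz _ _) _.
by rewrite ler_wpM2r// sumr_ge0// => j _; exact: sqr_ge0.
Qed.

(** A real [sup] is an upper bound only of a set that is bounded; the Frobenius norm bounds this
    one. Homogeneity then reduces a nonzero [x] to the unit ball. *)
Lemma spectral_norm_ge m n (M : 'M[R]_(m, n)) (x : 'cV[R]_n) :
  euclidean_norm (M *m x) <= spectral_norm M * euclidean_norm x.
Proof.
have ubM y : euclidean_norm y <= 1 -> euclidean_norm (M *m y) <= spectral_norm M.
  move=> y1; apply: ub_le_sup; last by exists y.
  exists (frobenius_norm M) => _ [z /= z1 <-].
  rewrite (le_trans (euclidean_norm_mulmx _ _))//.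
  by rewrite ler_piMr// frobenius_norm_ge0.
have [x0|x0] := eqVneq (euclidean_norm x) 0.
  by rewrite (euclidean_norm_eq0 x0) mulmx0 !euclidean_norm0 mulr0.
have xgt0 : 0 < euclidean_norm x by rewrite lt_neqAle eq_sym x0 euclidean_norm_ge0.
rewrite -ler_pdivrMr// mulrC -[X in X * _]ger0_norm ?invr_ge0 ?(ltW xgt0)//.
rewrite -euclidean_normZ scalemxAr; apply: ubM.
by rewrite euclidean_normZ ger0_norm ?invr_ge0 ?(ltW xgt0)// mulVf.
Qed.

Lemma spectral_norm_ge0 m n (M : 'M[R]_(m, n)) : 0 <= spectral_norm M.
Proof.
rewrite /spectral_norm -(euclidean_norm0 m); apply: ub_le_sup.
  exists (frobenius_norm M) => _ [z /= z1 <-].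
  rewrite (le_trans (euclidean_norm_mulmx _ _))//.
  by rewrite ler_piMr// frobenius_norm_ge0.
by exists 0; rewrite /= ?mulmx0// euclidean_norm0.
Qed.

End matrix_norms.

(** * One step of the subgradient method *)

Section subgradient_step.
Context {R : realType} {r n : nat}.
Variables (y c : 'cV[R]_r) (U : 'cV[R]_n) (G Gstar g : 'M[R]_(r, n)).
Let f (X : 'M[R]_(r, n)) := euclidean_norm (y - X *m U).
Hypothesis g_sub : subdifferential f G g.
Local Notation E := (G - Gstar).

(** Testing the subgradient inequality at [G + g] gives [|g|^2 <= f (G + g) - f G <= |g U| <= |g|
    |U|]. *)
Lemma subgradient_norm : frobenius_norm g <= euclidean_norm U.
Proof.
have := g_sub (g + G); rewrite addrK -sqr_frobenius_norm => le1.
have le2 : f (g + G) <= f G + euclidean_norm (g *m U).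
  have -> : f (g + G) = euclidean_norm (y - G *m U + - (g *m U)).
    by rewrite /f mulmxDl opprD addrA addrAC.
  by rewrite (le_trans (ler_euclidean_normD _ _))// euclidean_normN.
have le3 := euclidean_norm_mulmx g U.
have : frobenius_norm g * frobenius_norm g <= frobenius_norm g * euclidean_norm U.
  by rewrite -expr2; lra.
have [->|gN0] := eqVneq (frobenius_norm g) 0.
  by move=> _; exact: euclidean_norm_ge0.
by rewrite ler_pM2l// lt_neqAle eq_sym gN0 frobenius_norm_ge0.
Qed.

(** Testing at [Gstar] gives [<g, E> >= f G - f Gstar]. In all cases this is at least [- |E U|];
    without attack [f Gstar = |c|] and [f G >= |E U| - |c|], which yields [|E U| - 2 |c|]. *)
Lemma subgradient_gap (attacked : bool) :
  (~~ attacked -> y - Gstar *m U = c) ->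
  euclidean_norm (E *m U) * (1 - 2 * attacked%:R) - 2 * euclidean_norm c
    <= frobenius_dot g E.
Proof.
move=> cE; have := g_sub Gstar.
rewrite -(opprB G) frobenius_dotC frobenius_dotNl frobenius_dotC => le1.
have split_f : y - Gstar *m U = (y - G *m U) + E *m U.
  by rewrite mulmxBl addrA subrK.
have le2 : f Gstar <= f G + euclidean_norm (E *m U).
  by rewrite /f split_f ler_euclidean_normD.
have c0 := euclidean_norm_ge0 c.
case: attacked cE => /= [_|/(_ isT) cE]; first by lra.
have le3 : euclidean_norm (E *m U) <= f G + f Gstar.
  have -> : E *m U = (y - Gstar *m U) - (y - G *m U) by rewrite split_f addrAC subrr add0r.
  by rewrite addrC (le_trans (ler_euclidean_normD _ _))// euclidean_normN.
have fc : f Gstar = euclidean_norm c by rewrite /f cE.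
by rewrite fc in le1 le3; lra.
Qed.

(* The multiplier [lam] linearizes the gain: [X^2 / |g|^2 >= 2 lam X - lam^2 |g|^2]
   for [X = <g, E>]. *)
Lemma best_step (alpha gamma lam : R) (attacked : bool) :
  0 <= alpha <= 1 -> 0 <= lam -> g != 0 ->
  (~~ attacked -> y - Gstar *m U = c) ->
  let theta := frobenius_dot g E / frobenius_norm g ^+ 2 in
  Num.min (alpha * theta) ((2 - alpha) * theta) <= gamma
    <= Num.max (alpha * theta) ((2 - alpha) * theta) ->
  frobenius_norm (G - gamma *: g - Gstar) ^+ 2
    + (2 * alpha - alpha ^+ 2) * (2 * lam * euclidean_norm (E *m U)) <=
  frobenius_norm E ^+ 2 + (2 * alpha - alpha ^+ 2) *
    (4 * lam * euclidean_norm (E *m U) * attacked%:R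
     + 4 * lam * euclidean_norm c + lam ^+ 2 * euclidean_norm U ^+ 2).
Proof.
move=> /andP[alpha0 alpha1] lam0 gN0 cE; set X := frobenius_dot g E.
set q := frobenius_norm g; move=> theta gammaP.
have q_gt0 : 0 < q by exact: frobenius_norm_gt0.
have qU : q <= euclidean_norm U by exact: subgradient_norm.
have XE : X = theta * q ^+ 2 by rewrite /theta divfK// sqrf_eq0 gt_eqF.
(* As a product, the condition that [gamma] lies between the two endpoints no longer depends on the
   sign of [theta]. *)
have between : 0 <= (gamma - alpha * theta) * ((2 - alpha) * theta - gamma).
  have [t0|t0] := leP 0 theta.
    have le : alpha * theta <= (2 - alpha) * theta by rewrite ler_wpM2r//; lra.
    move: gammaP; rewrite (min_idPl le) (max_idPr le) => /andP[? ?].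
    by rewrite mulr_ge0// subr_ge0.
  have le : (2 - alpha) * theta <= alpha * theta by rewrite ler_wnM2r ?(ltW t0)//; lra.
  move: gammaP; rewrite (min_idPr le) (max_idPl le) => /andP[? ?].
  by rewrite -mulrNN mulr_ge0// oppr_ge0 subr_le0.
have expand : frobenius_norm (G - gamma *: g - Gstar) ^+ 2 =
    frobenius_norm E ^+ 2 - 2 * gamma * X + gamma ^+ 2 * q ^+ 2.
  have -> : G - gamma *: g - Gstar = E + (- gamma) *: g.
    by rewrite scaleNr addrAC.
  by rewrite sqr_frobenius_normDZ -/X -/q; ring.
have c0 : 0 <= 2 * alpha - alpha ^+ 2 by rewrite expr2; nra.
(* The decrease is a concave parabola in [gamma] that takes the value [(2 alpha - alpha^2) theta X]
   at both endpoints; what it exceeds this value by in between is [q^2] times the product in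
   [between]. *)
have gain : frobenius_norm (G - gamma *: g - Gstar) ^+ 2 <=
    frobenius_norm E ^+ 2 - (2 * alpha - alpha ^+ 2) * (theta * X).
  rewrite expand XE.
  have : 0 <= q ^+ 2 * ((gamma - alpha * theta) * ((2 - alpha) * theta - gamma)).
    by rewrite mulr_ge0// sqr_ge0.
  rewrite -subr_ge0 => h; rewrite -subr_ge0; apply: le_trans h _.
  by rewrite le_eqVlt; apply/orP; left; apply/eqP; ring.
(* The difference from [theta X] is [q^2 (theta - lam)^2] when [|g|] stands in place of [|U|]; the
   subgradient bound [|g| <= |U|] then removes [g] from the estimate. *)
have lin : 2 * lam * X - lam ^+ 2 * euclidean_norm U ^+ 2 <= theta * X.
  apply: (@le_trans _ _ (2 * lam * X - lam ^+ 2 * q ^+ 2)).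
    rewrite lerD2l lerN2 ler_wpM2l ?sqr_ge0// ler_sqr// nnegrE ?euclidean_norm_ge0//.
    exact: ltW.
  rewrite -subr_ge0 XE.
  have : 0 <= q ^+ 2 * (theta - lam) ^+ 2 by rewrite mulr_ge0// sqr_ge0.
  by move=> h; apply: le_trans h _; rewrite le_eqVlt; apply/orP; left; apply/eqP; ring.
have gap := ler_wpM2l lam0 (subgradient_gap cE).
rewrite -/X in gap.
have : 0 <= (2 * alpha - alpha ^+ 2) * (theta * X - (2 * (lam *
  (euclidean_norm (E *m U) * (1 - 2 * attacked%:R) - 2 * euclidean_norm c))
   - lam ^+ 2 * euclidean_norm U ^+ 2)).
  by rewrite mulr_ge0// subr_ge0; apply: le_trans lin; rewrite lerD2r -mulrA ler_wpM2l.
move: gain; set Ep := frobenius_norm _ ^+ 2; set E2 := frobenius_norm _ ^+ 2.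
set cc := 2 * alpha - alpha ^+ 2; set V := euclidean_norm (E *m U).
move=> h1 h2; rewrite -subr_ge0.
apply: le_trans (addr_ge0 h2 (_ : 0 <= E2 - cc * (theta * X) - Ep)) _.
  by rewrite subr_ge0.
by rewrite le_eqVlt; apply/orP; left; apply/eqP; ring.
Qed.

End subgradient_step.

(** * Measurability of matrix-valued functions *)

Section matrix_measurability.
Context {R : realType} {d} {T : measurableType d}.

Lemma measurable_mx_entry m n (i : 'I_m) (j : 'I_n) :
  measurable_fun setT (fun M : 'M[R]_(m, n) => M i j).
Proof.
move=> _ B mB; apply: sub_gen_smallest.
by exists (i, j) => //; exists B.
Qed.

Lemma measurable_fun_mxP m n (f : T -> 'M[R]_(m, n)) :
  measurable_fun setT f <-> forall i j, measurable_fun setT (fun x => f x i j).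
Proof.
split=> [mf i j|mf].
  by apply: (measurableT_comp (@measurable_mx_entry m n i j)).
pose gen := \bigcup_(ij in [set: 'I_m * 'I_n])
  preimage_set_system setT (fun M : 'M[R]_(m, n) => M ij.1 ij.2) measurable.
apply: (@measurability _ _ T 'M[R]_(m, n) setT f gen) => //.
move=> _ [_ [[i j] _ [B mB <-]] <-].
by rewrite setTI; have := mf i j measurableT B mB; rewrite !setTI.
Qed.

Lemma measurable_mxD m n (f g : T -> 'M[R]_(m, n)) : measurable_fun setT f ->
  measurable_fun setT g -> measurable_fun setT (fun x => f x + g x).
Proof.
move=> /measurable_fun_mxP mf /measurable_fun_mxP mg; apply/measurable_fun_mxP => i j.
by under eq_fun do rewrite mxE; exact: measurable_funD.
Qed.

Lemma measurable_mxB m n (f g : T -> 'M[R]_(m, n)) : measurable_fun setT f ->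
  measurable_fun setT g -> measurable_fun setT (fun x => f x - g x).
Proof.
move=> /measurable_fun_mxP mf /measurable_fun_mxP mg; apply/measurable_fun_mxP => i j.
by under eq_fun do rewrite !mxE; exact: measurable_funB.
Qed.

Lemma measurable_mxZ m n (c : T -> R) (f : T -> 'M[R]_(m, n)) : measurable_fun setT c ->
  measurable_fun setT f -> measurable_fun setT (fun x => c x *: f x).
Proof.
move=> mc /measurable_fun_mxP mf; apply/measurable_fun_mxP => i j.
by under eq_fun do rewrite mxE; exact: measurable_funM.
Qed.

Lemma measurable_mxM m n p (f : T -> 'M[R]_(m, n)) (g : T -> 'M[R]_(n, p)) :
  measurable_fun setT f -> measurable_fun setT g ->
  measurable_fun setT (fun x => f x *m g x).
Proof.
move=> /measurable_fun_mxP mf /measurable_fun_mxP mg; apply/measurable_fun_mxP => i j.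
under eq_fun do rewrite mxE; apply: measurable_sum => l.
exact: measurable_funM.
Qed.

Lemma measurable_fun_sqrt (f : T -> R) : measurable_fun setT f ->
  measurable_fun setT (fun x => Num.sqrt (f x)).
Proof.
apply: measurableT_comp.
by apply: continuous_measurable_fun; exact: sqrt_continuous.
Qed.

Lemma measurable_sqr_frobenius_norm m n (f : T -> 'M[R]_(m, n)) :
  measurable_fun setT f -> measurable_fun setT (fun x => frobenius_dot (f x) (f x)).
Proof.
move=> /measurable_fun_mxP mf; apply: measurable_sum => i.
by apply: measurable_sum => j; exact: measurable_funM.
Qed.

Lemma measurable_frobenius_norm m n (f : T -> 'M[R]_(m, n)) :
  measurable_fun setT f -> measurable_fun setT (fun x => frobenius_norm (f x)).
Proof. by move=> mf; apply: measurable_fun_sqrt; exact: measurable_sqr_frobenius_norm. Qed.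

Lemma measurable_euclidean_norm n (f : T -> 'cV[R]_n) :
  measurable_fun setT f -> measurable_fun setT (fun x => euclidean_norm (f x)).
Proof.
move=> /measurable_fun_mxP mf; apply: measurable_fun_sqrt.
by apply: measurable_sum => i; exact: measurable_funX.
Qed.

(** On nonnegative reals the inverse is the power of exponent [-1], also at 0, where both are 0. *)
Lemma measurable_fun_inv (f : T -> R) : (forall x, 0 <= f x) ->
  measurable_fun setT f -> measurable_fun setT (fun x => (f x)^-1).
Proof.
move=> f0 mf; under eq_fun do rewrite -powR_inv1//.
apply: (@measurableT_comp _ _ _ _ _ _ (fun y : R => y `^ (-1))) => //.
Qed.

End matrix_measurability.

(** * Linear images of Gaussian vectors *)

Section quartic_minorant.
Context {R : realType}.

(* The tangent at [y = 2] of [y + y^4 / 16 >= 3/4 y^2], for [y = |x| / (s l)]. *)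
Lemma quartic_minorant (s l x : R) : 0 < s -> 0 <= l -> (l = 0 -> x = 0) ->
  3 / 4 / s * x ^+ 2 <= l * `|x| + (16 * s ^+ 3 * l ^+ 2)^-1 * x ^+ 4.
Proof.
move=> s0; rewrite le_eqVlt => /orP[/eqP <- x0|l0 _].
  by rewrite x0// normr0 !expr0n/= !mulr0 addr0.
pose y := `|x| / (s * l).
have y0 : 0 <= y by rewrite divr_ge0// mulr_ge0// ltW.
have xE : `|x| = s * l * y by rewrite /y mulrC divfK// mulf_neq0// gt_eqF.
have x2E : x ^+ 2 = (s * l * y) ^+ 2 by rewrite -xE real_normK// num_real.
have x4E : x ^+ 4 = (s * l * y) ^+ 4 by rewrite (exprM x 2 2) x2E -exprM.
rewrite x2E x4E xE.
have -> : 3 / 4 / s * (s * l * y) ^+ 2 = s * l ^+ 2 * (3 / 4 * y ^+ 2).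
  by field; rewrite gt_eqF.
have -> : l * (s * l * y) + (16 * s ^+ 3 * l ^+ 2)^-1 * (s * l * y) ^+ 4 =
    s * l ^+ 2 * (y + y ^+ 4 / 16).
  by field; rewrite !gt_eqF.
have sl_ge0 : 0 <= s * l ^+ 2 by rewrite mulr_ge0 ?sqr_ge0// ltW.
rewrite ler_wpM2l// -subr_ge0.
have -> : y + y ^+ 4 / 16 - 3 / 4 * y ^+ 2 = y * (y - 2) ^+ 2 * (y + 4) / 16.
  by field.
by rewrite divr_ge0// mulr_ge0 ?addr_ge0// mulr_ge0// sqr_ge0.
Qed.

End quartic_minorant.

Section gaussian_moments.
Context d (T : measurableType d) (R : realType) (P : probability T R).
Variables (F : set (set T)) (N : nat) (v : 'I_N -> T -> R) (s : R).
Hypothesis F_measurable : F `<=` measurable.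
Hypotheses (FI : setI_closed F) (FT : F setT).
Hypothesis v_measurable : forall i, measurable_fun setT (v i).
Hypothesis s_gt0 : 0 < s.
(** Three facts in one formula: each [v i] has law N(0, s^2), the [v i] are independent of one
    another, and together they are independent of [F]. *)
Hypothesis v_gaussian : forall H (A : 'I_N -> set R), F H ->
  (forall i, measurable (A i)) ->
  (P (H `&` [set om | forall i, A i (v i om)]) =
   P H * \prod_(i < N) normal_prob 0 s (A i))%E.

(* A pi-system generating the sigma-algebra of [F] and of [v i], [i < j]. *)
Definition cylinders (j : nat) : set (set T) :=
  [set C | exists H, exists2 A : 'I_N -> set R,
     [/\ F H, forall i, measurable (A i) & forall i : 'I_N, (j <= i)%N -> A i = setT] &
     C = H `&` [set om | forall i, A i (v i om)]].

Lemma cylindersI j : setI_closed (cylinders j).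
Proof.
move=> _ _ [H [A [FH mA Aj] ->]] [H' [A' [FH' mA' Aj'] ->]].
exists (H `&` H'), (fun i => A i `&` A' i).
  split; first exact: FI.
    by move=> i; exact: measurableI.
  by move=> i ji; rewrite Aj// Aj'// setTI.
apply/seteqP; split => om /=.
  by move=> [[? Ai] [? A'i]]; split.
by move=> [[? ?] AA']; split; split => // i; have [] := AA' i.
Qed.

Lemma sub_cylinders j : F `<=` cylinders j.
Proof.
move=> H FH; exists H, (fun=> setT) => //.
by rewrite (_ : [set _ | _] = setT) ?setIT//; apply/seteqP.
Qed.

Lemma cylindersT j : cylinders j setT.
Proof. exact: sub_cylinders. Qed.

Lemma cylinders_measurable j : cylinders j `<=` measurable.
Proof.
move=> _ [H [A [FH mA _] ->]]; apply: measurableI; first exact: F_measurable.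
rewrite (_ : [set _ | _] = \bigcap_i (v i @^-1` A i)).
  apply: fin_bigcap_measurable => // i _.
  by rewrite -[X in measurable X]setTI; exact: v_measurable.
by apply/seteqP; split => om /= Ai i; [move=> _; exact: Ai|exact: Ai].
Qed.

Lemma preimage_cylinders j (i : 'I_N) B : (i < j)%N -> measurable B ->
  cylinders j (v i @^-1` B).
Proof.
move=> ij mB; exists setT, (fun i' => if i' == i then B else setT).
  split => // i'; first by case: ifP.
  by case: eqP => // ->; rewrite leqNgt ij.
rewrite setTI; apply/seteqP; split => om /=.
  by move=> Bv i'; case: eqP => // ->.
by move=> /(_ i); rewrite eqxx.
Qed.

Lemma cylinders_independent (j : 'I_N) C B : cylinders j C -> measurable B ->
  (P (C `&` v j @^-1` B) = P C * normal_prob 0 s B)%E.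
Proof.
move=> [H [A [FH mA Aj] ->]] mB.
pose A' i := if i == j then B else A i.
have mA' i : measurable (A' i) by rewrite /A'; case: ifP.
have -> : H `&` [set om | forall i, A i (v i om)] `&` v j @^-1` B =
    H `&` [set om | forall i, A' i (v i om)].
  apply/seteqP; split => om /=.
    move=> [[? Ai] Bj]; split => // i; rewrite /A'.
    by case: eqP => [->|_]; [|exact: Ai].
  move=> [? A'i]; split; [split => //|] => [i|].
    by have := A'i i; rewrite /A'; case: eqP => // -> _; rewrite Aj.
  by have := A'i j; rewrite /A' eqxx.
rewrite !v_gaussian// -muleA; congr (_ * _)%E.
rewrite (bigD1 j)//= [in RHS](bigD1 j)//= /A' eqxx (Aj j)// probability_setT mul1e muleC.
by congr (_ * _)%E; apply: eq_bigr => i /negbTE ->.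
Qed.

Lemma sigma_cylinders_independent (j : 'I_N) C B :
  <<s cylinders j >> C -> measurable B ->
  (P (C `&` v j @^-1` B) = P C * normal_prob 0 s B)%E.
Proof.
move=> sC mB.
have PvB : P (v j @^-1` B) = normal_prob 0 s B.
  rewrite -(setTI (v j @^-1` B)) (cylinders_independent (cylindersT j))//.
  by rewrite probability_setT mul1e.
rewrite -PvB; apply: (@g_sigma_algebra_independent _ _ _ P (cylinders j)) => //.
- exact: cylinders_measurable.
- exact: cylindersI.
- exact: cylindersT.
- by rewrite -[X in measurable X]setTI; exact: v_measurable.
- by move=> D cD; rewrite cylinders_independent// PvB.
Qed.

Let S j := g_sigma_algebraType (cylinders j).

Let measurable_lift j (f : T -> R) :
  measurable_fun setT (f : g_sigma_algebraType F -> R) ->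
  measurable_fun setT (f : S j -> R).
Proof.
apply: measurable_fun_g_sigma_algebra_sub.
by apply: (subset_trans (@sub_cylinders j)); exact: sub_gen_smallest.
Qed.

Lemma measurable_fun_coordinate j (i : 'I_N) : (i < j)%N ->
  measurable_fun setT (v i : S j -> R).
Proof.
move=> ij _ B mB; rewrite setTI; apply: sub_gen_smallest.
exact: preimage_cylinders.
Qed.

Section linear_combination.
Variable a : 'I_N -> T -> R.
Hypothesis a_measurable :
  forall i, measurable_fun setT (a i : g_sigma_algebraType F -> R).

(** Truncations of the linear form and of its squared coefficient norm. The former is measurable for
    [cylinders j], of which [v j] is independent: this lets the coordinates be integrated out one at
    a time. *)
Let partial_dot j om := \sum_(i < N | (i < j)%N) a i om * v i om.
Let partial_sqnorm j om := \sum_(i < N | (i < j)%N) a i om ^+ 2.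

Let sum_ltS (j : 'I_N) (f : 'I_N -> R) :
  \sum_(i < N | (i < j.+1)%N) f i = \sum_(i < N | (i < j)%N) f i + f j.
Proof.
rewrite (bigD1 j)//= addrC; congr (_ + _); apply: eq_bigl => i.
by rewrite ltnS ltn_neqAle andbC.
Qed.

Lemma measurable_partial_dot j : measurable_fun setT (partial_dot j : S j -> R).
Proof.
have -> : partial_dot j = fun om =>
    \sum_(i < N) if (i < j)%N then a i om * v i om else 0.
  by apply/funext => om; rewrite /partial_dot big_mkcond.
apply: measurable_sum => i /=; case: (ltnP i j) => // ij.
by apply: measurable_funM; [exact: measurable_lift|exact: measurable_fun_coordinate].
Qed.

Let measurable_partial_sqnorm j :
  measurable_fun setT (partial_sqnorm j : g_sigma_algebraType F -> R).
Proof.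
have -> : partial_sqnorm j = fun om =>
    \sum_(i < N) if (i < j)%N then a i om ^+ 2 else 0.
  by apply/funext => om; rewrite /partial_sqnorm big_mkcond.
apply: measurable_sum => i /=; case: (ltnP i j) => // ij.
by apply: measurable_funX.
Qed.

Let partial_sqnorm_ge0 j om : 0 <= partial_sqnorm j om.
Proof. by apply: sumr_ge0 => i _; rewrite sqr_ge0. Qed.

Let measurable_partial_dotT j : measurable_fun setT (partial_dot j).
Proof.
apply: (measurable_fun_g_sigma_algebraW (@cylinders_measurable j)).
exact: measurable_partial_dot.
Qed.

(** Freeze everything but [v j] in [partial_dot j + a j * v j]; then [Q] is the one-dimensional
    moment of an affine image of a centered Gaussian. The exponent is even so that the integrand is
    nonnegative and Tonelli applies. *)
Let integrate_out (j : 'I_N) (Z : T -> R) e (Q : R -> R -> R) :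
  measurable_fun setT (Z : g_sigma_algebraType F -> R) -> (forall om, 0 <= Z om) ->
  ~~ odd e ->
  (forall b c, \int[normal_prob 0 s]_z ((b + c * z) ^+ e)%:E = (Q b c)%:E)%E ->
  (\int[P]_om (Z om * partial_dot j.+1 om ^+ e)%:E =
   \int[P]_om (Z om * Q (partial_dot j om) (a j om))%:E)%E.
Proof.
move=> mZ Z0 e_even QE.
pose h (z : S j * R) : \bar R :=
  (Z z.1 * (partial_dot j z.1 + a j z.1 * z.2) ^+ e)%:E.
have mh : measurable_fun setT h.
  apply/measurable_EFinP; apply: measurable_funM.
    apply: (@measurableT_comp _ _ _ _ _ _ (Z : S j -> R)) => //.
    exact: measurable_lift.
  apply: measurable_funX; apply: measurable_funD.
    apply: (@measurableT_comp _ _ _ _ _ _ (partial_dot j : S j -> R)) => //.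
    exact: measurable_partial_dot.
  apply: measurable_funM => //.
  apply: (@measurableT_comp _ _ _ _ _ _ (a j : S j -> R)) => //.
  exact: measurable_lift.
have h0 z : (0 <= h z)%E by rewrite lee_fin mulr_ge0// exprn_even_ge0.
transitivity (\int[P]_om h (om, v j om))%E.
  by apply: eq_integral => om _; rewrite /partial_dot sum_ltS.
rewrite (@freezing _ _ _ P (cylinders j) (@cylinders_measurable j) _ _
  (normal_prob 0 s))//; last 2 first.
- exact: v_measurable.
- by move=> C B sC mB; exact: sigma_cylinders_independent.
apply: eq_integral => om _.
under eq_integral do rewrite /h/= EFinM.
rewrite ge0_integralZl//=; last 3 first.
- apply/measurable_EFinP; apply: measurable_funX; apply: measurable_funD => //.
- by move=> z _; rewrite lee_fin exprn_even_ge0.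
- by rewrite lee_fin.
by rewrite QE -EFinM.
Qed.

Let second_moment_partial (j : nat) : (j <= N)%N -> forall Z : T -> R,
  measurable_fun setT (Z : g_sigma_algebraType F -> R) -> (forall om, 0 <= Z om) ->
  (\int[P]_om (Z om * partial_dot j om ^+ 2)%:E =
   \int[P]_om (s ^+ 2 * Z om * partial_sqnorm j om)%:E)%E.
Proof.
elim: j => [_|j IH jN] Z mZ Z0.
  apply: eq_integral => om _; rewrite /partial_dot /partial_sqnorm.
  by rewrite !big_pred0_eq expr0n/= !mulr0.
rewrite (@integrate_out (Ordinal jN) Z 2 (fun b c => b ^+ 2 + c ^+ 2 * s ^+ 2))//; last first.
  by move=> b c; rewrite integral_normal_prob_sqr.
have mem := measurable_fun_g_sigma_algebraW F_measurable.
have maj := a_measurable (Ordinal jN).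
under eq_integral do rewrite mulrDr EFinD.
rewrite ge0_integralD//=; last 4 first.
- by move=> om _; rewrite lee_fin mulr_ge0 ?sqr_ge0.
- apply/measurable_EFinP/measurable_funM; first exact: mem.
  exact: measurable_funX.
- by move=> om _; rewrite lee_fin; nonneg.
- apply/measurable_EFinP/measurable_funM; first exact: mem.
  by apply: measurable_funM => //; apply: measurable_funX; exact: mem.
rewrite (IH (ltnW jN))// -ge0_integralD//=; last 4 first.
- by move=> om _; rewrite lee_fin; nonneg.
- apply/measurable_EFinP/measurable_funM; last exact: mem.
  by apply: measurable_funM => //; exact: mem.
- by move=> om _; rewrite lee_fin; nonneg.
- apply/measurable_EFinP/measurable_funM; first exact: mem.
  by apply: measurable_funM => //; apply: measurable_funX; exact: mem.
apply: eq_integral => om _; rewrite -EFinD; congr EFin.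
by rewrite /partial_sqnorm (sum_ltS (Ordinal jN)); ring.
Qed.

(** Integrating out one coordinate leaves three terms: the previous fourth moment, a second moment
    with a random coefficient, and a pure [a^4] term. They reassemble into [3 s^4 (S + a^2)^2], with
    [S] the previous [partial_sqnorm]. *)
Let fourth_moment_partial (j : nat) : (j <= N)%N -> forall Z : T -> R,
  measurable_fun setT (Z : g_sigma_algebraType F -> R) -> (forall om, 0 <= Z om) ->
  (\int[P]_om (Z om * partial_dot j om ^+ 4)%:E =
   \int[P]_om (3 * s ^+ 4 * Z om * partial_sqnorm j om ^+ 2)%:E)%E.
Proof.
elim: j => [_|j IH jN] Z mZ Z0.
  apply: eq_integral => om _; rewrite /partial_dot /partial_sqnorm.
  by rewrite !big_pred0_eq !expr0n/= !mulr0.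
have mem := measurable_fun_g_sigma_algebraW F_measurable.
have maj := a_measurable (Ordinal jN).
have majT := mem _ _ _ maj.
have mZT := mem _ _ _ mZ.
have mqT := mem _ _ _ (measurable_partial_sqnorm j).
(* The cross term is a second moment with this weight, which varies with [om] even if [Z] does
   not. *)
pose Z' om := 6 * a (Ordinal jN) om ^+ 2 * s ^+ 2 * Z om.
have mZ' : measurable_fun setT (Z' : g_sigma_algebraType F -> R).
  apply: measurable_funM => //; apply: measurable_funM => //.
  by apply: measurable_funM => //; exact: measurable_funX.
have Z'0 om : 0 <= Z' om by rewrite /Z'; nonneg.
rewrite (@integrate_out (Ordinal jN) Z 4 (fun b c =>
  b ^+ 4 + 6 * b ^+ 2 * c ^+ 2 * s ^+ 2 + 3 * c ^+ 4 * s ^+ 4))//; last first.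
  by move=> b c; rewrite integral_normal_prob_expr4.
transitivity (\int[P]_om ((Z om * partial_dot j om ^+ 4)%:E
    + (Z' om * partial_dot j om ^+ 2)%:E
    + (3 * s ^+ 4 * Z om * a (Ordinal jN) om ^+ 4)%:E))%E.
  by apply: eq_integral => om _; rewrite -!EFinD /Z' /=; congr EFin; ring.
have m1 i (f g : T -> R) : measurable_fun setT f -> measurable_fun setT g ->
    measurable_fun setT (fun om => (f om * g om ^+ i)%:E).
  move=> mf mg; apply/measurable_EFinP/measurable_funM => //.
  exact: measurable_funX.
have g1 om : (0 <= (Z om * partial_dot j om ^+ 4)%:E)%E.
  by rewrite lee_fin mulr_ge0// exprn_even_ge0.
have g2 om : (0 <= (Z' om * partial_dot j om ^+ 2)%:E)%E.
  by rewrite lee_fin mulr_ge0// exprn_even_ge0.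
have c0 om : 0 <= 3 * s ^+ 4 * Z om.
  by rewrite mulr_ge0// mulr_ge0// exprn_even_ge0.
have mcZ : measurable_fun setT (fun om => 3 * s ^+ 4 * Z om).
  exact: measurable_funM.
have g3 om : (0 <= (3 * s ^+ 4 * Z om * a (Ordinal jN) om ^+ 4)%:E)%E.
  by rewrite lee_fin mulr_ge0// exprn_even_ge0.
have mZ'T := mem _ _ _ mZ'.
rewrite ge0_integralD//=; last 3 first.
- by move=> om _; exact: adde_ge0.
- by apply: emeasurable_funD; exact: m1.
- exact: m1.
rewrite ge0_integralD//=; last 2 first.
- exact: m1.
- exact: m1.
rewrite (IH (ltnW jN))// (second_moment_partial (ltnW jN))//.
have g4 om : (0 <= (3 * s ^+ 4 * Z om * partial_sqnorm j om ^+ 2)%:E)%E.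
  by rewrite lee_fin mulr_ge0// sqr_ge0.
have g5 om : (0 <= (s ^+ 2 * Z' om * partial_sqnorm j om)%:E)%E.
  by rewrite lee_fin mulr_ge0// mulr_ge0// sqr_ge0.
have m5 : measurable_fun setT (fun om => (s ^+ 2 * Z' om * partial_sqnorm j om)%:E).
  apply/measurable_EFinP; apply: measurable_funM => //.
  exact: measurable_funM.
rewrite -ge0_integralD//=; last exact: m1.
rewrite -ge0_integralD//=; last 3 first.
- by move=> om _; exact: adde_ge0.
- by apply: emeasurable_funD => //; exact: m1.
- exact: m1.
apply: eq_integral => om _; rewrite -!EFinD; congr EFin.
by rewrite /partial_sqnorm (sum_ltS (Ordinal jN)) /Z'; ring.
Qed.

Let dot_all : partial_dot N = fun om => \sum_i a i om * v i om.
Proof. by apply/funext => om; apply: eq_bigl => i; rewrite ltn_ord. Qed.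

Let sqnorm_all : partial_sqnorm N = fun om => \sum_i a i om ^+ 2.
Proof. by apply/funext => om; apply: eq_bigl => i; rewrite ltn_ord. Qed.

Lemma gaussian_second_moment (Z : T -> R) :
  measurable_fun setT (Z : g_sigma_algebraType F -> R) -> (forall om, 0 <= Z om) ->
  (\int[P]_om (Z om * (\sum_i a i om * v i om) ^+ 2)%:E =
   \int[P]_om (s ^+ 2 * Z om * \sum_i a i om ^+ 2)%:E)%E.
Proof.
move=> mZ Z0; have := second_moment_partial (leqnn N) mZ Z0.
by rewrite dot_all sqnorm_all.
Qed.

Lemma gaussian_fourth_moment (Z : T -> R) :
  measurable_fun setT (Z : g_sigma_algebraType F -> R) -> (forall om, 0 <= Z om) ->
  (\int[P]_om (Z om * (\sum_i a i om * v i om) ^+ 4)%:E =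
   \int[P]_om (3 * s ^+ 4 * Z om * (\sum_i a i om ^+ 2) ^+ 2)%:E)%E.
Proof.
move=> mZ Z0; have := fourth_moment_partial (leqnn N) mZ Z0.
by rewrite dot_all sqnorm_all.
Qed.

End linear_combination.

Lemma gaussian_sqnorm (Z : T -> R) :
  measurable_fun setT (Z : g_sigma_algebraType F -> R) -> (forall om, 0 <= Z om) ->
  (\int[P]_om (Z om * \sum_i v i om ^+ 2)%:E =
   \int[P]_om (N%:R * s ^+ 2 * Z om)%:E)%E.
Proof.
move=> mZ Z0; have mZT := measurable_fun_g_sigma_algebraW F_measurable mZ.
transitivity (\sum_(i < N) \int[P]_om (Z om * v i om ^+ 2)%:E)%E.
  rewrite -ge0_integral_sum//=.
  - by apply: eq_integral => om _; rewrite mulr_sumr sumEFin.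
  - move=> i; apply/measurable_EFinP/measurable_funM => //.
    exact: measurable_funX.
  - by move=> i om _; rewrite lee_fin; nonneg.
transitivity (\sum_(i < N) \int[P]_om (s ^+ 2 * Z om)%:E)%E.
  apply: eq_bigr => i _.
  have ma i' : measurable_fun setT ((fun=> (i' == i)%:R) : g_sigma_algebraType F -> R).
    exact: measurable_cst.
  (* A single coordinate is the linear form whose coefficients are the [i]-th unit vector. *)
  have := @gaussian_second_moment (fun i' om => (i' == i)%:R) ma Z mZ Z0.
  have pick (c : 'I_N -> R) : \sum_i' (i' == i)%:R * c i' = c i.
    rewrite (bigD1 i)//= eqxx mul1r big1 ?addr0// => i' /negbTE ->.
    by rewrite mul0r.
  under eq_integral do rewrite pick.
  move=> ->; apply: eq_integral => om _; congr EFin.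
  by under eq_bigr do rewrite expr2; rewrite pick eqxx mulr1.
rewrite -ge0_integral_sum//=; last 2 first.
- move=> i; apply/measurable_EFinP/measurable_funM => //.
- by move=> i om _; rewrite lee_fin; nonneg.
apply: eq_integral => om _; rewrite sumEFin; congr EFin.
by rewrite sumr_const card_ord -[LHS]mulr_natl mulrA.
Qed.

(** Integrate the quartic minorant with [l] the norm of the coefficients: its quadratic term has
    mean [3/4 s l^2] and its quartic term [3 s^4 l^4 / (16 s^3 l^2) = 3/16 s l^2]. The difference,
    [9/16], is taken only later, when the integrals are known to be finite. *)
Lemma gaussian_abs_moment (a : 'I_N -> T -> R) :
  (forall i, measurable_fun setT (a i : g_sigma_algebraType F -> R)) ->
  (\int[P]_om (3 / 4 * s * \sum_i a i om ^+ 2)%:E <=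
   \int[P]_om (Num.sqrt (\sum_i a i om ^+ 2) * `|\sum_i a i om * v i om|)%:E +
   \int[P]_om (3 / 16 * s * \sum_i a i om ^+ 2)%:E)%E.
Proof.
move=> ma.
pose q om := \sum_i a i om ^+ 2.
pose x om := \sum_i a i om * v i om.
have q0 om : 0 <= q om by apply: sumr_ge0 => i _; exact: sqr_ge0.
have sn := gt_eqF s_gt0.
have mq : measurable_fun setT (q : g_sigma_algebraType F -> R).
  by apply: measurable_sum => i; exact: measurable_funX.
(* Where [q] vanishes this weight is 0, by the convention on the inverse; this is consistent, as the
   linear form then vanishes too, by Cauchy-Schwarz. *)
pose Z om := (16 * s ^+ 3 * q om)^-1.
have c0 om : 0 <= 16 * s ^+ 3 * q om.
  by rewrite mulr_ge0// mulr_ge0// exprn_ge0// ltW.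
have mZ : measurable_fun setT (Z : g_sigma_algebraType F -> R).
  by apply: measurable_fun_inv => //; exact: measurable_funM.
have Z0 om : 0 <= Z om by rewrite invr_ge0.
have mqT := measurable_fun_g_sigma_algebraW F_measurable mq.
have mZT := measurable_fun_g_sigma_algebraW F_measurable mZ.
have mx : measurable_fun setT x.
  apply: measurable_sum => i; apply: measurable_funM => //.
  exact: measurable_fun_g_sigma_algebraW (ma i).
have c1_ge0 : 0 <= 3 / 4 / s by rewrite !divr_ge0// ltW.
have := @gaussian_second_moment a ma (fun=> 3 / 4 / s) (measurable_cst _)
  (fun=> c1_ge0).
have -> : (\int[P]_om (s ^+ 2 * (3 / 4 / s) * \sum_i a i om ^+ 2)%:E =
    \int[P]_om (3 / 4 * s * \sum_i a i om ^+ 2)%:E)%E.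
  by apply: eq_integral => om _; congr EFin; congr (_ * _); field; rewrite sn.
move=> <-.
have -> : (\int[P]_om (3 / 16 * s * \sum_i a i om ^+ 2)%:E =
    \int[P]_om (Z om * x om ^+ 4)%:E)%E.
  rewrite gaussian_fourth_moment//; apply: eq_integral => om _; congr EFin.
  rewrite -/(q om) /Z; have [->|qn] := eqVneq (q om) 0.
    by rewrite expr0n/= !mulr0.
  by field; rewrite qn sn.
have msqrt : measurable_fun setT (fun om => Num.sqrt (q om)).
  exact: measurable_fun_sqrt.
have mabs : measurable_fun setT (fun om => `|x om|) by exact: measurableT_comp.
have m1 : measurable_fun setT (fun om => (Num.sqrt (q om) * `|x om|)%:E).
  by apply/measurable_EFinP; exact: measurable_funM.
have m2 : measurable_fun setT (fun om => (Z om * x om ^+ 4)%:E).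
  by apply/measurable_EFinP/measurable_funM => //; exact: measurable_funX.
have p1 om : (0 <= (Num.sqrt (q om) * `|x om|)%:E)%E.
  by rewrite lee_fin mulr_ge0 ?sqrtr_ge0.
have p2 om : (0 <= (Z om * x om ^+ 4)%:E)%E.
  by rewrite lee_fin mulr_ge0// exprn_even_ge0.
rewrite -ge0_integralD//=.
apply: ge0_le_integral => //=.
- by move=> om _; rewrite lee_fin mulr_ge0 ?sqr_ge0.
- by apply/measurable_EFinP/measurable_funM => //; exact: measurable_funX.
- exact: emeasurable_funD.
move=> om _; rewrite -EFinD lee_fin -/(q om) -/(x om).
have := @quartic_minorant R s (Num.sqrt (q om)) (x om) s_gt0 (sqrtr_ge0 _).
rewrite sqr_sqrtr//; apply => /eqP; rewrite sqrtr_eq0 => q_le0.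
have q_eq0 : q om = 0 by apply/eqP; rewrite eq_le q_le0 q0.
have := cauchy_schwarz (a ^~ om) (v ^~ om).
rewrite -/(q om) -/(x om) q_eq0 mul0r => x2.
by apply/eqP; rewrite -sqrf_eq0 eq_le x2 sqr_ge0.
Qed.

(** Row by row: if [l i] is the squared norm of row [i] and [x i] its product with the Gaussian
    vector, Cauchy-Schwarz over the rows bounds the sum of [sqrt (l i) |x i|] by [|M|_F |M v|], and
    the scalar estimate applies to each row. *)
Lemma gaussian_norm_moment r (M : T -> 'M[R]_(r, N)) :
  measurable_fun setT (M : g_sigma_algebraType F -> 'M[R]_(r, N)) ->
  (\int[P]_om (3 / 4 * s * frobenius_norm (M om) ^+ 2)%:E <=
   \int[P]_om (frobenius_norm (M om) * euclidean_norm (M om *m \col_i v i om))%:E +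
   \int[P]_om (3 / 16 * s * frobenius_norm (M om) ^+ 2)%:E)%E.
Proof.
move=> mM; have /measurable_fun_mxP mMij := mM.
have mMT := measurable_fun_g_sigma_algebraW F_measurable mM.
have mMijT i j := measurable_fun_g_sigma_algebraW F_measurable (mMij i j).
pose l i om := \sum_j M om i j ^+ 2.
pose x i om := \sum_j M om i j * v j om.
have l0 i om : 0 <= l i om by apply: sumr_ge0 => j _; exact: sqr_ge0.
have ml i : measurable_fun setT (l i).
  by apply: measurable_sum => j; exact: measurable_funX.
have mx i : measurable_fun setT (x i).
  by apply: measurable_sum => j; exact: measurable_funM.
have s0 := ltW s_gt0.
have normE om : frobenius_norm (M om) ^+ 2 = \sum_i l i om.
  by rewrite sqr_frobenius_norm; apply: eq_bigr => i _; apply: eq_bigr.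
have sum_norm c : 0 <= c ->
    (\int[P]_om (c * s * frobenius_norm (M om) ^+ 2)%:E =
     \sum_(i < r) \int[P]_om (c * s * l i om)%:E)%E.
  move=> c0; rewrite -ge0_integral_sum//=.
  - by apply: eq_integral => om _; rewrite normE mulr_sumr sumEFin.
  - by move=> i; apply/measurable_EFinP; exact: measurable_funM.
  - by move=> i om _; rewrite lee_fin !mulr_ge0.
rewrite !sum_norm ?divr_ge0//.
apply: (@le_trans _ _ (\sum_(i < r) (
    \int[P]_om (Num.sqrt (l i om) * `|x i om|)%:E
    + \int[P]_om (3 / 16 * s * l i om)%:E))%E).
  by apply: lee_sum => i _; apply: gaussian_abs_moment => j; exact: mMij.
rewrite big_split/= leeD2r// -ge0_integral_sum//=; last first.
  move=> i; apply/measurable_EFinP/measurable_funM; first exact: measurable_fun_sqrt.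
  exact: measurableT_comp.
apply: ge0_le_integral => //=.
- by move=> om _; rewrite sumEFin lee_fin sumr_ge0// => i _; rewrite mulr_ge0 ?sqrtr_ge0.
- apply: emeasurable_sum => i; apply/measurable_EFinP/measurable_funM.
    exact: measurable_fun_sqrt.
  exact: measurableT_comp.
- apply/measurable_EFinP/measurable_funM; first exact: measurable_frobenius_norm.
  apply: measurable_euclidean_norm; apply: measurable_mxM => //.
  apply/measurable_fun_mxP => i j; rewrite (_ : (fun _ => _) = v i)//.
  by apply/funext => om; rewrite mxE.
move=> om _; rewrite sumEFin lee_fin; apply: le_trans (ler_norm _) _.
have e0 := mulr_ge0 (frobenius_norm_ge0 (M om)) (euclidean_norm_ge0 (M om *m \col_i v i om)).
rewrite -ler_sqr ?nnegrE// real_normK ?num_real// exprMn normE sqr_euclidean_norm.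
apply: le_trans (cauchy_schwarz _ _) _.
under eq_bigr do rewrite sqr_sqrtr//.
rewrite le_eqVlt; apply/orP; left; apply/eqP; congr (_ * _).
apply: eq_bigr => i _; rewrite real_normK ?num_real// mxE; congr (_ ^+ 2).
by apply: eq_bigr => j _; rewrite mxE.
Qed.

End gaussian_moments.

(** * Inputs and attacks over one window *)

Lemma measurable_exists d (S : measurableType d) k (b : 'I_k -> S -> bool) :
  (forall j, measurable_fun setT (b j)) ->
  measurable_fun setT (fun om => [exists j, b j om]).
Proof.
move=> mb; apply: (@measurable_fun_bool _ _ _ _ true).
have -> : setT `&` (fun om => [exists j, b j om]) @^-1` [set true] =
    \bigcup_(j in setT) (b j @^-1` [set true]).
  rewrite setTI; apply/seteqP; split => om /=.
    by move=> /existsP[j bj]; exists j.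
  by move=> [j _ bj]; apply/existsP; exists j.
apply: fin_bigcup_measurable => // j _.
by rewrite -[X in measurable X]setTI; exact: mb.
Qed.

(** Independence is stated for finite sets of indices; the image of [f] is one, and injectivity lets
    each index in it recover its own event. Outside the image [E'] takes the default value
    [setT]. *)
Lemma mutually_independent_inj d (T : measurableType d) (R : realType)
    (P : probability T R) (I : choiceType) (F : I -> set (set T))
    k (f : 'I_k -> I) (E : 'I_k -> set T) :
  mutually_independent P F -> injective f -> (forall j, F (f j) (E j)) ->
  P (\bigcap_j E j) = (\prod_(j < k) P (E j))%E.
Proof.
move=> indep f_inj FE.
pose E' i := if [pick j | f j == i] is Some j then E j else setT.
have E'f j : E' (f j) = E j.
  by rewrite /E'; case: pickP => [j' /eqP/f_inj ->//|/(_ j)]; rewrite eqxx.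
have := indep [fset f j | j in 'I_k]%fset E'.
rewrite big_imfset/=; last by move=> j j' _ _; exact: f_inj.
have -> : \bigcap_(i in [set` [fset f j | j in 'I_k]%fset]) E' i = \bigcap_j E j.
  apply/seteqP; split => om /= EP.
    by move=> j _; rewrite -E'f; apply: EP; rewrite /= in_imfset.
  by move=> _ /imfsetP[j _ ->]; rewrite E'f; exact: EP.
move=> ->; last by move=> _ /imfsetP[j _ ->]; rewrite E'f.
by rewrite big_enum; apply: eq_bigr => j _; rewrite E'f.
Qed.

Lemma big_tagnat (R : Type) (idx : R) (op : Monoid.com_law idx) k m
    (f : 'I_(\sum_(j < k) m) -> R) :
  \big[op/idx]_i f i = \big[op/idx]_(j < k) \big[op/idx]_(l < m) f (tagnat.Rank j l).
Proof.
rewrite sig_big_dep/= (reindex _ tagnat.rank_bij_on)/=.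
by apply: eq_bigr => z _; rewrite tagnat.rankE.
Qed.

Section input_independence.
Context d (T : measurableType d) (R : realType) (P : probability T R).
Context n m (x0 : {RV P >-> 'cV[R]_n}) (u : nat -> {RV P >-> 'cV[R]_m})
  (w : nat -> {RV P >-> 'cV[R]_n}) (xi : nat -> {RV P >-> bool}).
Variables (p s : R).
Hypothesis xi_bernoulli : forall t (b : set bool),
  distribution P (xi t) b = bernoulli_prob p b.
Hypothesis xi_indep : mutually_independent P
  (fun t => g_sigma_algebra_preimage (xi t)).
Hypothesis u_gaussian : forall t, is_isotropic_gaussian s (distribution P (u t)).
Hypothesis u_indep : mutually_independent P
  (fun t => g_sigma_algebra_preimage (u t)).
Hypothesis future_indep : forall t, mutually_independent P
  (tnth [tuple sigma_family [set s | (t <= s)%N] u;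
               sigma_family [set s | (t <= s)%N] xi;
               history x0 w u t]).

Lemma future_independent t H V X : history x0 w u t H ->
  sigma_family [set s | (t <= s)%N] u V -> sigma_family [set s | (t <= s)%N] xi X ->
  P (H `&` V `&` X) = (P H * P V * P X)%E.
Proof.
move=> HH VV XX; pose E := tnth [tuple V; X; H].
have := @mutually_independent_inj _ _ _ P _ _ 3 id E (@future_indep t) (@inj_id _).
have -> : \bigcap_j E j = H `&` V `&` X.
  apply/seteqP; split => om /=.
    by move=> Eom; split; [split; [exact: (Eom 2%R)|exact: (Eom 0%R)]|exact: (Eom 1%R)].
  by move=> [[Hom Vom] Xom] [[|[|[|j]]] j3]//.
move=> ->; last by move=> [[|[|[|j]]] j3].
by rewrite !big_ord_recl big_ord0 /E !(tnth_nth setT)/= mule1 muleA [LHS]muleC muleA.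
Qed.

Variables (k t : nat).

(** Of the attacks from time [t] on, [y_(t+k-1)] involves only those at times [t] to [t + k - 2],
    hence [k - 1] indices. The event is expressed by [xi], independent of the past, and not by the
    attacks themselves, which may depend on it. *)
Definition attacked (om : T) : bool := [exists j : 'I_(k - 1), xi (t + j)%N om].

Local Notation H := (history x0 w u t).
Let U (i : 'I_(\sum_(j < k) m)) (om : T) : R :=
  stacked_input k (fun s => u s om) (t + k - 1) i 0.

Lemma history_measurable : H `<=` measurable.
Proof.
apply: smallest_sub; first exact: sigma_algebra_measurable.
move=> A [[|]|].
- by move=> [B mB <-]; exact: measurable_funP.
- by move=> [j _ [B mB <-]]; exact: measurable_funP.
- by move=> [j _ [B mB <-]]; exact: measurable_funP.
Qed.

Lemma historyI : setI_closed H.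
Proof.
move=> A B HA HB; exact: (@measurableI _ (g_sigma_algebraType _) A B HA HB).
Qed.

Lemma historyT : H setT.
Proof. exact: (@measurableT _ (g_sigma_algebraType _)). Qed.

Let U_E j l om : U (tagnat.Rank j l) om = u (t + k - 1 - j)%N om l 0.
Proof.
have sig2E : tagnat.sig2 (tagnat.Rank j l) = l :> 'I_m.
  by apply: val_inj; rewrite /= tagnat.Rank2K.
by rewrite /U /stacked_input mxE tagnat.Rank1K sig2E.
Qed.

Lemma measurable_stacked_input i : measurable_fun setT (U i).
Proof.
rewrite /U /stacked_input; under eq_fun do rewrite mxE.
apply: (measurableT_comp (@measurable_mx_entry _ _ _ _ _)).
exact: measurable_funP.
Qed.

Let box (A : 'I_(\sum_(j < k) m) -> set R) j : set 'cV[R]_m :=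
  [set z | forall l, A (tagnat.Rank j l) (z l 0)].

Let measurable_box A j : (forall i, measurable (A i)) -> measurable (box A j).
Proof.
move=> mA; rewrite (_ : box A j = \bigcap_(l in setT)
    ((fun z : 'cV[R]_m => z l 0) @^-1` A (tagnat.Rank j l))).
  apply: fin_bigcap_measurable => // l _.
  by rewrite -[X in measurable X]setTI; exact: measurable_mx_entry.
by apply/seteqP; split => z /= zA l; [move=> _; exact: zA|exact: zA].
Qed.

Let boxE A : [set om | forall i, A i (U i om)] =
  \bigcap_(j in [set: 'I_k]) (u (t + k - 1 - j)%N @^-1` box A j).
Proof.
apply/seteqP; split => om /= Aom.
  by move=> j _ l; rewrite -U_E; exact: Aom.
move=> i; have := Aom (tagnat.sig1 i) Logic.I (tagnat.sig2 i).
by rewrite -U_E tagnat.sig2K.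
Qed.

Let measurable_sigma_family d' (S : measurableType d') (X : nat -> T -> S) j :
  (t <= j)%N -> measurable_fun setT (X j : g_sigma_algebraType
    (\bigcup_(i in [set i | (t <= i)%N]) g_sigma_algebra_preimage (X i)) -> S).
Proof.
move=> tj _ B mB; apply: sub_gen_smallest; exists j => //.
by exists B.
Qed.

Let future_box A : (forall i, measurable (A i)) ->
  sigma_family [set i | (t <= i)%N] u [set om | forall i, A i (U i om)].
Proof.
move=> mA; rewrite boxE.
apply: (@fin_bigcap_measurable _ (g_sigma_algebraType _)) => // j _.
have tj : (t <= t + k - 1 - j)%N by have := ltn_ord j; lia.
have mu := @measurable_sigma_family _ _ (fun i om => u i om) _ tj.
by rewrite -[X in measurable X]setTI; apply: mu => //; exact: measurable_box.
Qed.

Let prob_box A : (forall i, measurable (A i)) ->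
  (P [set om | forall i, A i (U i om)] = \prod_i normal_prob 0 s (A i))%E.
Proof.
move=> mA; rewrite boxE.
rewrite (@mutually_independent_inj _ _ _ P _ _ _
  (fun j : 'I_k => (t + k - 1 - j)%N) _ u_indep); last 2 first.
- move=> i j /= ij; apply: val_inj => /=.
  by have := ltn_ord i; have := ltn_ord j; lia.
- by move=> j; exists (box A j); [exact: measurable_box|rewrite setTI].
rewrite big_tagnat; apply: eq_bigr => j _.
exact: (u_gaussian (t + k - 1 - j) (fun l => mA (tagnat.Rank j l))).
Qed.

(** This provides the joint Gaussian hypothesis of the moment lemmas, with the history as the
    conditioning sigma-algebra. *)
Lemma stacked_input_gaussian C A : H C -> (forall i, measurable (A i)) ->
  (P (C `&` [set om | forall i, A i (U i om)]) =
   P C * \prod_i normal_prob 0 s (A i))%E.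
Proof.
move=> HC mA; rewrite -prob_box//.
rewrite -[X in P X]setIT (@future_independent t)//; last 2 first.
- exact: future_box.
- exact: (@measurableT _ (g_sigma_algebraType _)).
by rewrite probability_setT mule1.
Qed.

Lemma measurable_attacked : measurable_fun setT attacked.
Proof. by apply: measurable_exists => j; exact: measurable_funP. Qed.

HB.instance Definition _ := isMeasurableFun.Build _ _ _ _ attacked measurable_attacked.

(** The cylinders involve both the history and the inputs of the window, so independence of the
    three sources jointly is used, not just in pairs. *)
Lemma attacked_independent j C B : cylinders H U j C ->
  (P (C `&` attacked @^-1` B) = P C * P (attacked @^-1` B))%E.
Proof.
move=> [C' [A [HC mA _] ->]].
have attB : sigma_family [set i | (t <= i)%N] xi (attacked @^-1` B).
  rewrite -[X in sigma_family _ _ X]setTI.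
  apply: (@measurable_exists _ (g_sigma_algebraType _) _ (fun j om => xi (t + j)%N om)) => // i.
  exact: (@measurable_sigma_family _ _ (fun i om => xi i om) _ (leq_addr i t)).
rewrite (@future_independent t)//; last exact: future_box.
by rewrite stacked_input_gaussian// prob_box.
Qed.

Lemma prob_attacked : 0 <= p <= 1 ->
  P (attacked @^-1` [set true]) = (1 - (1 - p) ^+ (k - 1))%:E.
Proof.
move=> p01.
have -> : attacked @^-1` [set true] =
    ~` (\bigcap_(j in [set: 'I_(k - 1)]) (xi (t + j)%N @^-1` [set false])).
  apply/seteqP; split => om /=.
    by move=> /existsP[j xij] /(_ j Logic.I)/=; rewrite xij.
  move=> nall; apply: contrapT => natt; apply: nall => j _ /=.
  by apply/negbTE/negP => xij; apply: natt; apply/existsP; exists j.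
have mxi j : measurable (xi (t + j)%N @^-1` [set false]).
  by rewrite -[X in measurable X]setTI; exact: measurable_funP.
rewrite probability_setC; last exact: fin_bigcap_measurable.
rewrite (@mutually_independent_inj _ _ _ P _ _ _
  (fun j : 'I_(k - 1) => (t + j)%N) _ xi_indep); last 2 first.
- by move=> i j /= /addnI ij; exact: val_inj.
- by move=> j; exists [set false] => //; rewrite setTI.
under eq_bigr.
  move=> j _.
  have -> : P (xi (t + j)%N @^-1` [set false]) = (1 - p)%:E.
    transitivity (bernoulli_prob p [set false]); first exact: xi_bernoulli.
    by rewrite bernoulli_probE// !diracE !in_set1/= mule0 add0e mule1.
  over.
by rewrite prodEFin prodr_const card_ord EFinB.
Qed.

End input_independence.

(** * Second moments of the state *)

Section second_moments.
Context d (T : measurableType d) (R : realType) (P : probability T R).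

Let integral_prob_cst (c : R) : (\int[P]_om c%:E = c%:E)%E.
Proof. by rewrite integral_cst//= probability_setT mule1. Qed.

(** Integrating [1 + z <= e^z] at [z = X^2 / s^2] gives [1 + E[X^2] / s^2 <= 2]. *)
Lemma exp_sqr_second_moment (X : T -> R) (s : R) : 0 < s ->
  measurable_fun setT X ->
  (\int[P]_om (expR (X om ^+ 2 / s ^+ 2))%:E <= 2%:E)%E ->
  (\int[P]_om (X om ^+ 2)%:E <= (s ^+ 2)%:E)%E.
Proof.
move=> s0 mX le2.
have s2_gt0 : 0 < s ^+ 2 by rewrite exprn_gt0.
have mX2 : measurable_fun setT (fun om => (X om ^+ 2 / s ^+ 2)%:E).
  apply/measurable_EFinP; apply: measurable_funM => //.
  exact: measurable_funX.
have X20 om : 0 <= X om ^+ 2 / s ^+ 2 by rewrite divr_ge0 ?sqr_ge0.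
have X20E om : (0 <= (X om ^+ 2 / s ^+ 2)%:E)%E by rewrite lee_fin.
have : (1 + \int[P]_om (X om ^+ 2 / s ^+ 2)%:E <= 2%:E)%E.
  apply: le_trans le2.
  rewrite -[X in (X + _)%E](integral_prob_cst 1) -ge0_integralD//=.
  apply: ge0_le_integral => //=.
  - by move=> om _; rewrite -EFinD lee_fin addr_ge0.
  - exact: emeasurable_funD.
  - apply/measurable_EFinP; apply: measurableT_comp => //.
    exact/measurable_EFinP.
  - by move=> om _; rewrite -EFinD lee_fin expR_ge1Dx.
have -> : 2%:E = (1 + 1%:E)%E :> \bar R by rewrite -EFinD.
rewrite leeD2lE// => le1.
rewrite (_ : (\int[P]_om (X om ^+ 2)%:E =
    (s ^+ 2)%:E * \int[P]_om (X om ^+ 2 / s ^+ 2)%:E)%E).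
  by rewrite -[leRHS]mule1 lee_pmul2l.
rewrite -ge0_integralZl//=; last by rewrite lee_fin ltW.
by apply: eq_integral => om _; rewrite -EFinM mulrC divfK// gt_eqF.
Qed.

(** Rather than showing that the infimum is attained, the proof picks an admissible [s] below
    [2 * eta]; this costs the factor 4. *)
Lemma psi2_norm_second_moment (X : T -> R) (eta : R) : 0 < eta ->
  measurable_fun setT X -> (psi2_norm P X <= eta%:E)%E ->
  (\int[P]_om (X om ^+ 2)%:E <= ((2 * eta) ^+ 2)%:E)%E.
Proof.
move=> eta0 mX le_eta.
have : (psi2_norm P X < (2 * eta)%:E)%E.
  by apply: le_lt_trans le_eta _; rewrite lte_fin; lra.
move=> /ereal_inf_lt[_ [s [s0 sE] <-]]; rewrite lte_fin => s_lt.
apply: le_trans (_ : (s ^+ 2)%:E <= _)%E.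
  by apply: exp_sqr_second_moment => //; move: sE; rewrite unlock.
by rewrite lee_fin ler_sqr ?nnegrE ?ltW// mulr_gt0.
Qed.

(** Integrated over the whole space, the conditional bound becomes an unconditional one. Here [eta]
    is itself admissible, so no factor is lost. *)
Lemma cond_psi2_norm_second_moment (F : set (set T)) (X : T -> R) (eta : R) :
  0 < eta -> measurable_fun setT X -> F `<=` measurable -> F setT ->
  cond_psi2_norm_le P F X eta ->
  (\int[P]_om (X om ^+ 2)%:E <= (eta ^+ 2)%:E)%E.
Proof.
move=> eta0 mX Fm FT [Y [Y0 mY YE] Y2].
apply: exp_sqr_second_moment => //; rewrite -(YE _ FT).
rewrite -[leRHS](integral_prob_cst 2).
apply: ae_ge0_le_integral => //.
- by move=> _ B mB; rewrite setTI; exact/Fm/mY.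
- by apply: filterS Y2 => om.
Qed.

(** Cauchy-Schwarz with weights [rho^i] bounds the square by [c] times the sum of [rho^i e_i^2],
    where [c <= 1 / (1 - rho)]; the mean of that sum supplies the second factor [c]. Any dependence
    between the [e i] is allowed. *)
Lemma geometric_second_moment (rho M : R) k (e : 'I_k -> T -> R) :
  0 <= rho < 1 -> 0 <= M -> (forall i, measurable_fun setT (e i)) ->
  (forall i, (\int[P]_om (e i om ^+ 2)%:E <= M%:E)%E) ->
  (\int[P]_om ((\sum_(i < k) rho ^+ i * e i om) ^+ 2)%:E <= (M / (1 - rho) ^+ 2)%:E)%E.
Proof.
move=> /andP[rho0 rho1] M0 me eM.
pose c := \sum_(i < k) rho ^+ i.
have c0 : 0 <= c by apply: sumr_ge0 => i _; exact: exprn_ge0.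
have r1 : 0 < 1 - rho by rewrite subr_gt0.
have c_le : c <= (1 - rho)^-1.
  rewrite -[leRHS]mul1r ler_pdivlMr// /c -[rho in 1 - rho]mul1r.
  have := subrXX 1 rho k; rewrite expr1n mul1r mulrC.
  under eq_bigr do rewrite expr1n mul1r.
  by move=> <-; rewrite gerBl exprn_ge0.
apply: (@le_trans _ _ (\int[P]_om (\sum_(i < k) (c * rho ^+ i)%:E * (e i om ^+ 2)%:E))%E).
  apply: ge0_le_integral => //=.
  - by move=> om _; rewrite lee_fin sqr_ge0.
  - apply/measurable_EFinP; apply: measurable_funX; apply: measurable_sum => i.
    exact: measurable_funM.
  - apply: emeasurable_sum => i; apply: measurable_funeM.
    by apply/measurable_EFinP; exact: measurable_funX.
  - move=> om _.
    have -> : (\sum_(i < k) (c * rho ^+ i)%:E * (e i om ^+ 2)%:E)%E =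
        (\sum_(i < k) c * rho ^+ i * e i om ^+ 2)%:E.
      by rewrite -sumEFin; apply: eq_bigr => i _; rewrite EFinM.
    rewrite lee_fin.
    have := @cauchy_schwarz R 'I_k (fun i : 'I_k => Num.sqrt (rho ^+ i))
      (fun i : 'I_k => Num.sqrt (rho ^+ i) * e i om).
    have sq (i : nat) : Num.sqrt (rho ^+ i) ^+ 2 = rho ^+ i by rewrite sqr_sqrtr// exprn_ge0.
    rewrite (eq_bigr (fun i : 'I_k => rho ^+ i * e i om)); last first.
      by move=> i _; rewrite mulrA -expr2 sq.
    rewrite (eq_bigr (fun i : 'I_k => rho ^+ i) (fun i _ => sq i)) -/c.
    rewrite (eq_bigr (fun i : 'I_k => rho ^+ i * e i om ^+ 2)
      (fun i _ => etrans (exprMn _ _ _) (congr1 ( *%R^~ _) (sq i)))).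
    move=> /le_trans; apply; rewrite mulr_sumr.
    by rewrite le_eqVlt; apply/orP; left; apply/eqP; apply: eq_bigr => i _; rewrite mulrA.
rewrite ge0_integral_sum//=; last 2 first.
- move=> i; apply: measurable_funeM.
  by apply/measurable_EFinP; exact: measurable_funX.
- by move=> i om _; rewrite mule_ge0// lee_fin ?sqr_ge0// mulr_ge0// exprn_ge0.
have cr (i : nat) : 0 <= c * rho ^+ i by rewrite mulr_ge0// exprn_ge0.
apply: (@le_trans _ _ (\sum_(i < k) (c * rho ^+ i * M)%:E)%E).
  apply: lee_sum => i _; rewrite ge0_integralZl//=; last 3 first.
  - by apply/measurable_EFinP; exact: measurable_funX.
  - by move=> om _; rewrite lee_fin sqr_ge0.
  - by rewrite lee_fin.
  by rewrite [leRHS]EFinM lee_wpmul2l// lee_fin.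
rewrite sumEFin lee_fin -mulr_suml -mulr_sumr -/c.
rewrite -expr2 mulrC ler_wpM2l// -exprVn ler_sqr ?nnegrE//.
by rewrite invr_ge0 ltW.
Qed.

End second_moments.

(** * Unrolling the linear dynamics *)

Section dynamics.
Context {R : realType} {n m r : nat}.
Variables (A : 'M[R]_n) (B : 'M[R]_(n, m)) (C : 'M[R]_(r, n)) (D : 'M[R]_(r, m)).
Variables (x w : nat -> 'cV[R]_n) (u : nat -> 'cV[R]_m) (y : nat -> 'cV[R]_r).
Hypothesis x_step : forall t, x t.+1 = A *m x t + B *m u t + w t.
Hypothesis y_eq : forall t, y t = C *m x t + D *m u t.

Lemma state_unroll t j : x (t + j)%N =
  A ^+ j *m x t + \sum_(i < j) A ^+ i *m (B *m u (t + j - i.+1)%N + w (t + j - i.+1)%N).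
Proof.
elim: j => [|j IH].
  by rewrite addn0 big_ord0 addr0 expr0; exact/esym/mul1mx.
rewrite addnS x_step IH mulmxDr exprS -addrA -addrA; congr (_ + _).
  by rewrite mulmxA.
rewrite big_ord_recl/= subn1/= expr0 [RHS]addrC mulmx_sumr; congr (_ + _).
  apply: eq_bigr => i _; rewrite mulmxA exprS.
  by rewrite /bump/= add1n subSS.
exact/esym/mul1mx.
Qed.

(** Unrolled over the [k - 1] steps from [t], the inputs reach the output exactly through the blocks
    of [markov_matrix], so in the absence of attacks only the propagated state remains. *)
Lemma attack_free_observation k t : (0 < k)%N ->
  (forall i, (i < k - 1)%N -> w (t + i)%N = 0) ->
  y (t + k - 1)%N - markov_matrix A B C D k *m stacked_input k u (t + k - 1)
    = C *m (A ^+ (k - 1) *m x t).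
Proof.
case: k => // k _; rewrite subn1/= addnS subn1/= => w0.
rewrite y_eq state_unroll /markov_matrix /stacked_input mul_mxrow_mxcol.
rewrite big_ord_recl/= subn0 mulmxDr.
set S := \sum_(i < k) _; set S' := \sum_(i < k) _.
suff -> : C *m S = S' by rewrite -(addrA (C *m _)) (addrC S') addrK.
rewrite /S mulmx_sumr; apply: eq_bigr => i _.
have ti : (t + k - i.+1 = t + (k - i.+1))%N by have := ltn_ord i; lia.
rewrite ti w0; last by have := ltn_ord i; lia.
by rewrite addr0 add0n !mulmxA.
Qed.

Lemma attack_free_observation_norm k t (psi rho : R) :
  (forall t, spectral_norm (A ^+ t) <= psi * rho ^+ t) ->
  euclidean_norm (C *m (A ^+ (k - 1) *m x t)) <=
  spectral_norm C * psi * rho ^+ (k - 1) * euclidean_norm (x t).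
Proof.
move=> A_stable; apply: le_trans (spectral_norm_ge _ _) _.
rewrite -!mulrA ler_wpM2l ?spectral_norm_ge0// mulrA.
apply: le_trans (spectral_norm_ge _ _) _.
by rewrite ler_wpM2r// euclidean_norm_ge0.
Qed.

(** The initial state is stored as the last term, [i = t], so that one geometric sum covers it along
    with the inputs and the attacks. *)
Lemma state_norm t (psi rho : R) :
  (forall t, spectral_norm (A ^+ t) <= psi * rho ^+ t) ->
  euclidean_norm (x t) <= psi * \sum_(i < t.+1) rho ^+ i *
    (if (i < t)%N then spectral_norm B * euclidean_norm (u (t - i.+1)%N)
        + euclidean_norm (w (t - i.+1)%N) else euclidean_norm (x 0%N)).
Proof.
move=> A_stable; have step i (z : 'cV[R]_n) c : euclidean_norm z <= c ->
    euclidean_norm (A ^+ i *m z) <= psi * (rho ^+ i * c).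
  move=> zc; apply: le_trans (spectral_norm_ge _ _) _.
  rewrite mulrA; apply: ler_pM => //; first exact: spectral_norm_ge0.
  exact: euclidean_norm_ge0.
rewrite -[t in x t]add0n state_unroll add0n big_ord_recr/= ltnn mulrDr addrC.
apply: le_trans (ler_euclidean_normD _ _) _; apply: lerD; last exact: step.
rewrite mulr_sumr.
apply: le_trans (_ : \sum_(i < t) euclidean_norm
    (A ^+ i *m (B *m u (t - i.+1)%N + w (t - i.+1)%N)) <= _).
  elim/big_rec2 : _ => [|i a b _ ab]; first by rewrite euclidean_norm0.
  by apply: le_trans (ler_euclidean_normD _ _) _; rewrite lerD2l.
apply: ler_sum => i _; rewrite ltn_ord; apply: step.
apply: le_trans (ler_euclidean_normD _ _) _.
by rewrite lerD2r spectral_norm_ge.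
Qed.

End dynamics.

Section state_moments.
Context {d} {T : measurableType d} {R : realType} (P : probability T R).
Context {n m : nat} (x0 : {RV P >-> 'cV[R]_n}) (u : nat -> {RV P >-> 'cV[R]_m})
  (w : nat -> {RV P >-> 'cV[R]_n}).
Variables (s eta : R).
Hypotheses (s_gt0 : 0 < s) (eta_gt0 : 0 < eta).
Hypothesis u_gaussian : forall t, is_isotropic_gaussian s (distribution P (u t)).
Hypothesis x0_psi2 :
  (psi2_norm P (fun om => euclidean_norm (x0 om)) <= eta%:E)%E.
Hypothesis w_psi2 : forall t, cond_psi2_norm_le P (attack_filtration x0 w t)
  (fun om => euclidean_norm (w t om)) eta.

Lemma initial_second_moment :
  (\int[P]_om (euclidean_norm (x0 om) ^+ 2)%:E <= ((2 * eta) ^+ 2)%:E)%E.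
Proof.
apply: psi2_norm_second_moment => //.
by apply: measurable_euclidean_norm; exact: measurable_funP.
Qed.

Lemma attack_second_moment t :
  (\int[P]_om (euclidean_norm (w t om) ^+ 2)%:E <= (eta ^+ 2)%:E)%E.
Proof.
apply: (cond_psi2_norm_second_moment eta_gt0 _ _ _ (w_psi2 t)).
- by apply: measurable_euclidean_norm; exact: measurable_funP.
- apply: smallest_sub; first exact: sigma_algebra_measurable.
  by move=> A [|[j _]] [B mB <-]; exact: measurable_funP.
- exact: (@measurableT _ (g_sigma_algebraType _)).
Qed.

Lemma input_second_moment t :
  (\int[P]_om (euclidean_norm (u t om) ^+ 2)%:E = (m%:R * s ^+ 2)%:E)%E.
Proof.
have mv i : measurable_fun setT (fun om => u t om i 0).
  by have /measurable_fun_mxP := measurable_funPT (u t); exact.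
(* The unconditional moment is the case of the trivial pi-system and of weight 1. *)
have := @gaussian_sqnorm _ _ _ P [set setT] m (fun i om => u t om i 0) s _ _ _ mv s_gt0 _
  (fun=> 1) (measurable_cst _) (fun=> ler01).
under eq_integral do rewrite mul1r -sqr_euclidean_norm.
move=> ->.
- by rewrite mulr1 integral_cst//= probability_setT mule1.
- by move=> A ->.
- by move=> A B -> ->; rewrite setTI.
- by [].
- move=> H A -> mA; rewrite setTI probability_setT mul1e.
  exact: u_gaussian mA.
Qed.

Lemma state_second_moment (A : 'M[R]_n) (B : 'M[R]_(n, m)) (x : nat -> T -> 'cV[R]_n)
    (psi rho : R) t :
  (forall om, x 0%N om = x0 om) ->
  (forall t om, x t.+1 om = A *m x t om + B *m u t om + w t om) ->
  0 < psi -> 0 <= rho < 1 ->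
  (forall t, spectral_norm (A ^+ t) <= psi * rho ^+ t) ->
  measurable_fun setT (x t) ->
  (\int[P]_om (euclidean_norm (x t om) ^+ 2)%:E <=
   (4 * psi ^+ 2 * (eta + Num.sqrt m%:R * spectral_norm B * s) ^+ 2
     / (1 - rho) ^+ 2)%:E)%E.
Proof.
move=> x_init x_step psi_gt0 rho01 A_stable mxt.
pose e (i : 'I_t.+1) om := if (i < t)%N
  then spectral_norm B * euclidean_norm (u (t - i.+1)%N om)
        + euclidean_norm (w (t - i.+1)%N om) else euclidean_norm (x 0%N om).
have mu j : measurable_fun setT (fun om => euclidean_norm (u j om)).
  by apply: measurable_euclidean_norm; exact: measurable_funP.
have mw j : measurable_fun setT (fun om => euclidean_norm (w j om)).
  by apply: measurable_euclidean_norm; exact: measurable_funP.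
have mx0 : measurable_fun setT (fun om => euclidean_norm (x 0%N om)).
  rewrite (_ : x 0%N = x0); last exact/funext.
  by apply: measurable_euclidean_norm; exact: measurable_funP.
have me i : measurable_fun setT (e i).
  rewrite /e; case: (ltnP i t) => // _; apply: measurable_funD => //.
  exact: measurable_funM.
have B0 := spectral_norm_ge0 B.
(* A common bound for all terms: the 4 comes from the bound [(2 eta)^2] on the initial state, and it
   also covers [2 |B|^2 m s^2 + 2 eta^2], obtained for the others from
   [(x + y)^2 <= 2 x^2 + 2 y^2]. *)
pose M := 4 * (eta + Num.sqrt m%:R * spectral_norm B * s) ^+ 2.
have M0 : 0 <= M by rewrite mulr_ge0// sqr_ge0.
have eM i : (\int[P]_om (e i om ^+ 2)%:E <= M%:E)%E.
  have q0 : 0 <= Num.sqrt m%:R * spectral_norm B * s :> R.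
    by rewrite !mulr_ge0 ?sqrtr_ge0// ltW.
  rewrite /e; case: (ltnP i t) => _; last first.
    have -> : x 0%N = x0 by exact/funext.
    apply: le_trans initial_second_moment _; rewrite lee_fin /M exprMn.
    rewrite (_ : 2 ^+ 2 = 4)//; last by rewrite expr2; lra.
    by rewrite ler_wpM2l// ler_sqr ?nnegrE ?addr_ge0 ?(ltW eta_gt0)// lerDl.
  set b := spectral_norm B; set j := (t - i.+1)%N.
  apply: (@le_trans _ _ (\int[P]_om ((2 * b ^+ 2)%:E * (euclidean_norm (u j om) ^+ 2)%:E
      + 2%:E * (euclidean_norm (w j om) ^+ 2)%:E))%E).
    apply: ge0_le_integral => //=.
    - by move=> om _; rewrite lee_fin sqr_ge0.
    - apply/measurable_EFinP; apply: measurable_funX; apply: measurable_funD => //.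
      exact: measurable_funM.
    - by apply: emeasurable_funD; apply: measurable_funeM;
        apply/measurable_EFinP; exact: measurable_funX.
    - move=> om _; rewrite -!EFinM -EFinD lee_fin -subr_ge0.
      set a := euclidean_norm _; set c := euclidean_norm _.
      have -> : 2 * b ^+ 2 * a ^+ 2 + 2 * c ^+ 2 - (b * a + c) ^+ 2 = (b * a - c) ^+ 2.
        by ring.
      exact: sqr_ge0.
  rewrite ge0_integralD//=; last 4 first.
  - by move=> om _; rewrite mule_ge0// lee_fin ?sqr_ge0// mulr_ge0// sqr_ge0.
  - by apply: measurable_funeM; apply/measurable_EFinP; exact: measurable_funX.
  - by move=> om _; rewrite mule_ge0// lee_fin sqr_ge0.
  - by apply: measurable_funeM; apply/measurable_EFinP; exact: measurable_funX.
  have mu2 : measurable_fun setT (fun om => (euclidean_norm (u j om) ^+ 2)%:E).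
    by apply/measurable_EFinP; exact: measurable_funX.
  have mw2 : measurable_fun setT (fun om => (euclidean_norm (w j om) ^+ 2)%:E).
    by apply/measurable_EFinP; exact: measurable_funX.
  have b2 : (0 <= (2 * b ^+ 2)%:E)%E by rewrite lee_fin mulr_ge0// sqr_ge0.
  have sq0 k (z : T -> 'cV[R]_k) om : (0 <= (euclidean_norm (z om) ^+ 2)%:E)%E.
    by rewrite lee_fin sqr_ge0.
  rewrite !ge0_integralZl//= input_second_moment.
  apply: (@le_trans _ _ ((2 * b ^+ 2)%:E * (m%:R * s ^+ 2)%:E + 2%:E * (eta ^+ 2)%:E)%E).
    by rewrite leeD2l// lee_wpmul2l// attack_second_moment.
  rewrite -!EFinM -EFinD lee_fin /M -/b -[m%:R in leLHS](@sqr_sqrtr _ m%:R)//.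
  rewrite -subr_ge0; move: q0; rewrite -/b; set h := Num.sqrt _ => q0.
  have -> : 4 * (eta + h * b * s) ^+ 2 - (2 * b ^+ 2 * (h ^+ 2 * s ^+ 2) + 2 * eta ^+ 2)
    = 2 * eta ^+ 2 + 8 * eta * (h * b * s) + 2 * (h * b * s) ^+ 2 by ring.
  by have eta_ge0 := ltW eta_gt0; nonneg.
have rho_ge0 : 0 <= rho by case/andP: rho01.
have mS : measurable_fun setT (fun om => (\sum_(i < t.+1) rho ^+ i * e i om) ^+ 2).
  by apply: measurable_funX; apply: measurable_sum => i; exact: measurable_funM.
apply: (@le_trans _ _ (\int[P]_om ((psi ^+ 2)%:E *
    ((\sum_(i < t.+1) rho ^+ i * e i om) ^+ 2)%:E))%E).
  apply: ge0_le_integral => //=.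
  - by move=> om _; rewrite lee_fin sqr_ge0.
  - apply/measurable_EFinP; apply: measurable_funX.
    exact: measurable_euclidean_norm.
  - by apply: measurable_funeM; exact/measurable_EFinP.
  - move=> om _; rewrite -EFinM lee_fin -exprMn.
    have e_ge0 i : 0 <= e i om.
      by rewrite /e; case: ifP => _; rewrite ?addr_ge0 ?mulr_ge0 ?euclidean_norm_ge0.
    rewrite ler_sqr ?nnegrE ?euclidean_norm_ge0//; last first.
      by rewrite mulr_ge0 ?(ltW psi_gt0)// sumr_ge0// => i _; rewrite mulr_ge0// exprn_ge0.
    exact: (@state_norm R n m A B (x ^~ om) (w ^~ om) (u ^~ om) (x_step ^~ om)).
rewrite ge0_integralZl//=; last 3 first.
- exact/measurable_EFinP.
- by move=> om _; rewrite lee_fin sqr_ge0.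
- by rewrite lee_fin sqr_ge0.
apply: (@le_trans _ _ ((psi ^+ 2)%:E * (M / (1 - rho) ^+ 2)%:E)%E).
  rewrite lee_wpmul2l ?lee_fin ?sqr_ge0//.
  exact: geometric_second_moment.
rewrite -EFinM lee_fin /M le_eqVlt; apply/orP; left; apply/eqP; ring.
Qed.

End state_moments.

(** * Contraction of the expected error *)

Section expected_step.
Context d (T : measurableType d) (R : realType) (P : probability T R).

Let integralD (f g : T -> R) : measurable_fun setT f -> measurable_fun setT g ->
  (forall om, 0 <= f om) -> (forall om, 0 <= g om) ->
  (\int[P]_om (f om + g om)%:E = \int[P]_om (f om)%:E + \int[P]_om (g om)%:E)%E.
Proof.
move=> mf mg f0 g0; rewrite -ge0_integralD//; try exact/measurable_EFinP.
- by move=> om _; rewrite lee_fin.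
- by move=> om _; rewrite lee_fin.
Qed.

Let integralZ (c : R) (f : T -> R) : 0 <= c -> measurable_fun setT f ->
  (forall om, 0 <= f om) ->
  (\int[P]_om (c * f om)%:E = c%:E * \int[P]_om (f om)%:E)%E.
Proof.
move=> c0 mf f0; rewrite -ge0_integralZl//; try exact/measurable_EFinP.
by move=> om _; rewrite lee_fin.
Qed.

(* [L], [V], [W], [b] stand for [|E|_F], [|E U|], [|U|] and [|C A^(k-1) x_t|].
   With [M = N s^2], bounding [4 beta L b] by [beta^2 M L^2 / 4 + 16 b^2 / M]
   leaves the gain [(9/8) (1 - 2 q) s beta - (5/4) M beta^2], and
   [beta = (9/20) (1 - 2 q) / (N s)] maximizes it. *)
Lemma expected_step (L V W b Ep : T -> R) (att : T -> bool) (c q s B0 e : R) (N : nat) :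
  0 <= c -> 0 <= q -> 2 * q < 1 -> 0 < s -> (0 < N)%N ->
  measurable_fun setT L -> measurable_fun setT V -> measurable_fun setT W ->
  measurable_fun setT b -> measurable_fun setT Ep -> measurable_fun setT att ->
  (forall om, 0 <= L om) -> (forall om, 0 <= V om <= L om * W om) ->
  (forall om, 0 <= W om) -> (forall om, 0 <= b om) ->
  (forall beta, 0 <= beta -> {ae P, forall om,
     Ep om ^+ 2 + c * (2 * (beta * L om) * V om) <= L om ^+ 2 +
     c * (4 * (beta * L om) * V om * (att om)%:R + 4 * (beta * L om) * b om
          + (beta * L om) ^+ 2 * W om ^+ 2)}) ->
  (\int[P]_om (L om ^+ 2)%:E = e%:E)%E ->
  (\int[P]_om (L om * V om * (att om)%:R)%:E = q%:E * \int[P]_om (L om * V om)%:E)%E ->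
  (\int[P]_om (L om ^+ 2 * W om ^+ 2)%:E = (N%:R * s ^+ 2 * e)%:E)%E ->
  ((3 / 4 * s * e)%:E <= \int[P]_om (L om * V om)%:E + (3 / 16 * s * e)%:E)%E ->
  (\int[P]_om (b om ^+ 2)%:E <= B0%:E)%E ->
  (\int[P]_om (Ep om ^+ 2)%:E <=
    ((1 - c * (1 - 2 * q) ^+ 2 / (4 * N%:R)) * e + 16 * c * B0 / (N%:R * s ^+ 2))%:E)%E.
Proof.
move=> c0 q0 q1 s0 N0 mL mV mW mb mEp matt L0 VLW W0 b0 step eE attE LWE LV_ge bE.
have V0 om : 0 <= V om by case/andP: (VLW om).
have N_gt0 : 0 < N%:R :> R by rewrite ltr0n.
pose M := N%:R * s ^+ 2.
have M0 : 0 < M by rewrite mulr_gt0// exprn_gt0.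
pose beta := 9 / 20 * (1 - 2 * q) / (N%:R * s).
have beta0 : 0 <= beta.
  by rewrite divr_ge0 ?mulr_ge0 ?divr_ge0// ?subr_ge0 ltW.
have mL2 : measurable_fun setT (fun om => L om ^+ 2) by exact: measurable_funX.
have mb2 : measurable_fun setT (fun om => b om ^+ 2) by exact: measurable_funX.
have mW2 : measurable_fun setT (fun om => W om ^+ 2) by exact: measurable_funX.
have mEp2 : measurable_fun setT (fun om => Ep om ^+ 2) by exact: measurable_funX.
have mLV : measurable_fun setT (fun om => L om * V om) by exact: measurable_funM.
have mLW : measurable_fun setT (fun om => L om ^+ 2 * W om ^+ 2).
  exact: measurable_funM.
have mattR : measurable_fun setT (fun om => (att om)%:R : R).
  by apply: (@measurableT_comp _ _ _ _ _ _ (fun x : bool => x%:R : R)).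
have mLVa : measurable_fun setT (fun om => L om * V om * (att om)%:R).
  exact: measurable_funM.
have L2_0 om : 0 <= L om ^+ 2 by exact: sqr_ge0.
have b2_0 om : 0 <= b om ^+ 2 by exact: sqr_ge0.
have Ep2_0 om : 0 <= Ep om ^+ 2 by exact: sqr_ge0.
have LV_0 om : 0 <= L om * V om by exact: mulr_ge0.
have LW_0 om : 0 <= L om ^+ 2 * W om ^+ 2 by rewrite mulr_ge0 ?sqr_ge0.
have LVa_0 om : 0 <= L om * V om * (att om)%:R by rewrite mulr_ge0.
(* Finiteness follows from [L V <= L^2 W <= L^2 + L^2 W^2], whose two integrals are known. *)
have LV_fin : (\int[P]_om (L om * V om)%:E)%E \is a fin_num.
  rewrite ge0_fin_numE; last by apply: integral_ge0 => om _; rewrite lee_fin.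
  apply: (@le_lt_trans _ _ (\int[P]_om (L om ^+ 2 + L om ^+ 2 * W om ^+ 2)%:E)%E).
    apply: ge0_le_integral => //=.
    - by move=> om _; rewrite lee_fin.
    - exact/measurable_EFinP.
    - by apply/measurable_EFinP; exact: measurable_funD.
    - move=> om _; rewrite lee_fin.
      apply: (@le_trans _ _ (L om ^+ 2 * W om)).
        by rewrite expr2 -mulrA ler_wpM2l//; case/andP: (VLW om).
      have : 0 <= L om ^+ 2 * ((W om - 1) ^+ 2 + W om ^+ 2 + 1).
        by rewrite mulr_ge0// !addr_ge0// sqr_ge0.
      rewrite -(pmulr_rge0 _ (_ : 0 < 2^-1 :> R))// => h; rewrite -subr_ge0.
      by apply: le_trans h _; rewrite le_eqVlt; apply/orP; left; apply/eqP; field.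
  by rewrite integralD// eE LWE -EFinD ltry.
set I := (\int[P]_om (L om * V om)%:E)%E in LV_ge attE LV_fin.
pose v := fine I; have IE : I = v%:E by rewrite fineK.
rewrite IE -EFinD lee_fin in LV_ge; rewrite IE -EFinM in attE.
pose k1 := 1 + c * beta ^+ 2 * M / 4.
pose k2 := 4 * c * beta.
pose k3 := 16 * c / M.
pose k4 := c * beta ^+ 2.
have k1_0 : 0 <= k1.
  by rewrite addr_ge0// divr_ge0// mulr_ge0 ?(ltW M0)// mulr_ge0// sqr_ge0.
have k2_0 : 0 <= k2 by rewrite /k2; nonneg.
have k3_0 : 0 <= k3 by rewrite divr_ge0 ?(ltW M0)// mulr_ge0.
have k4_0 : 0 <= k4 by rewrite mulr_ge0// sqr_ge0.
have c2_0 : 0 <= 2 * c * beta by nonneg.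
pose rhs om := k1 * L om ^+ 2 + k2 * (L om * V om * (att om)%:R)
  + k3 * b om ^+ 2 + k4 * (L om ^+ 2 * W om ^+ 2).
have m1 : measurable_fun setT (fun om => k1 * L om ^+ 2) by exact: measurable_funM.
have m2 : measurable_fun setT (fun om => k2 * (L om * V om * (att om)%:R)).
  exact: measurable_funM.
have m3 : measurable_fun setT (fun om => k3 * b om ^+ 2) by exact: measurable_funM.
have m4 : measurable_fun setT (fun om => k4 * (L om ^+ 2 * W om ^+ 2)).
  exact: measurable_funM.
have m12 := measurable_funD m1 m2; have m123 := measurable_funD m12 m3.
have mc : measurable_fun setT (fun om => 2 * c * beta * (L om * V om)).
  exact: measurable_funM.
have p1 om : 0 <= k1 * L om ^+ 2 by exact: mulr_ge0.
have p2 om : 0 <= k2 * (L om * V om * (att om)%:R) by exact: mulr_ge0.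
have p3 om : 0 <= k3 * b om ^+ 2 by exact: mulr_ge0.
have p4 om : 0 <= k4 * (L om ^+ 2 * W om ^+ 2) by exact: mulr_ge0.
have pc om : 0 <= 2 * c * beta * (L om * V om) by exact: mulr_ge0.
have p12 om : 0 <= k1 * L om ^+ 2 + k2 * (L om * V om * (att om)%:R).
  exact: addr_ge0.
have p123 om : 0 <= k1 * L om ^+ 2 + k2 * (L om * V om * (att om)%:R) + k3 * b om ^+ 2.
  exact: addr_ge0.
(* The gain stays on the left, so that both integrands are nonnegative; it is moved to the right
   only as the real number [v]. *)
have main : (\int[P]_om (Ep om ^+ 2)%:E + (2 * c * beta * v)%:E <=
    (k1 * e + k2 * (q * v) + k3 * B0 + k4 * (M * e))%:E)%E.
  apply: (@le_trans _ _ (\int[P]_om (rhs om)%:E)%E).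
    rewrite EFinM -IE /I -integralZ// -integralD//.
    apply: ae_ge0_le_integral => //=.
    - by move=> om _; rewrite lee_fin addr_ge0.
    - by apply/measurable_EFinP; exact: measurable_funD.
    - by move=> om _; rewrite lee_fin addr_ge0.
    - by apply/measurable_EFinP; exact: measurable_funD.
    - apply: filterS (step _ beta0) => om step_om _; rewrite lee_fin.
      apply: (@le_trans _ _ (L om ^+ 2 + c * (4 * (beta * L om) * V om * (att om)%:R
          + 4 * (beta * L om) * b om + (beta * L om) ^+ 2 * W om ^+ 2))).
        apply: le_trans step_om; rewrite le_eqVlt; apply/orP; left; apply/eqP; ring.
      have : 0 <= c / M * (M * beta * L om / 2 - 4 * b om) ^+ 2.
        by rewrite mulr_ge0 ?sqr_ge0// divr_ge0// ltW.
      move=> h; rewrite -subr_ge0; apply: le_trans h _.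
      rewrite le_eqVlt; apply/orP; left; apply/eqP.
      by rewrite /rhs /k1 /k2 /k3 /k4; field; rewrite gt_eqF.
  rewrite /rhs integralD// integralD// integralD// !integralZ// eE attE LWE.
  rewrite -[N%:R * s ^+ 2]/M -!EFinM -!EFinD.
  rewrite -addeA -[leRHS]/(((k1 * e + k2 * (q * v)) + k3 * B0 + k4 * (M * e))%:E).
  rewrite -[in leRHS]addrA [leRHS]EFinD leeD2l// [leRHS]EFinD leeD2r//.
  by rewrite [leRHS]EFinM lee_wpmul2l.
rewrite -leeBrDr// -EFinB in main; apply: le_trans main _; rewrite lee_fin.
have v_ge : 9 / 16 * s * e <= v by lra.
have gain : 0 <= 2 * c * beta * (1 - 2 * q) * (v - 9 / 16 * s * e).
  by rewrite mulr_ge0 ?subr_ge0// mulr_ge0// subr_ge0 ltW.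
have e0 : 0 <= e.
  by rewrite -lee_fin -eE; apply: integral_ge0 => om _; rewrite lee_fin.
(* [1/320] is the excess of the gain [81/320] over the stated [1/4]. *)
have slack : 0 <= c * (1 - 2 * q) ^+ 2 / N%:R * e * (1 / 320).
  apply: mulr_ge0; last by rewrite divr_ge0.
  by apply: mulr_ge0 => //; rewrite divr_ge0 ?(ltW N_gt0)// mulr_ge0// sqr_ge0.
rewrite -subr_ge0; apply: le_trans (addr_ge0 gain slack) _.
rewrite le_eqVlt; apply/orP; left; apply/eqP.
by rewrite /k1 /k2 /k3 /k4 /beta /M; field; rewrite !gt_eqF.
Qed.

End expected_step.

(** * The scalar recursion and its constants *)

(** [noise] is the fixed point of [e |-> (1 - kappa) e + kappa noise], so the excess over it
    contracts and the noise does not accumulate. *)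
Lemma contraction_step (R : realFieldType) (kappa a e0 e noise z : R) :
  0 <= kappa <= 1 -> e <= a * e0 + noise -> z <= (1 - kappa) * e + kappa * noise ->
  z <= (1 - kappa) * a * e0 + noise.
Proof.
move=> /andP[k0 k1] e_le z_le; apply: le_trans z_le _.
have : 0 <= (1 - kappa) * (a * e0 + noise - e) by rewrite mulr_ge0// subr_ge0.
lra.
Qed.

(** Bernoulli's inequality [(1 - p)^j >= 1 - j p] gives [2 q <= 2 (k - 1) p < 1]. *)
Lemma attack_probability_bounds (R : realType) (p : R) k : (1 < k)%N ->
  0 <= p -> p < (2 * (k - 1))%:R^-1 ->
  [/\ p <= 1, 0 <= 1 - (1 - p) ^+ (k - 1) & 2 * (1 - (1 - p) ^+ (k - 1)) < 1].
Proof.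
rewrite -subn_gt0 => k_gt0 p_ge0 p_lt.
have c_gt0 : 0 < (2 * (k - 1))%:R :> R by rewrite ltr0n muln_gt0.
have pk : 2 * ((k - 1)%:R * p) < 1.
  have : (2 * (k - 1))%:R * p < (2 * (k - 1))%:R * (2 * (k - 1))%:R^-1.
    by rewrite ltr_pM2l.
  by rewrite divff ?gt_eqF// natrM mulrA.
have p_le1 : p <= 1.
  by have : p <= (k - 1)%:R * p; [rewrite ler_peMl// ler1n|lra].
have bernoulli j : 1 - j%:R * p <= (1 - p) ^+ j.
  elim: j => [|j IH]; first by rewrite mul0r subr0 expr0.
  have := ler_wpM2l (_ : 0 <= 1 - p) IH; rewrite subr_ge0 => /(_ p_le1).
  rewrite exprS; apply: le_trans.
  have : 0 <= j%:R * p ^+ 2 by rewrite mulr_ge0 ?sqr_ge0.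
  by rewrite -natr1; lra.
split=> //; last by have := bernoulli (k - 1)%N; lra.
by rewrite subr_ge0 exprn_ile1// ?subr_ge0// gerBl.
Qed.

Lemma relaxation_gain_bounds (R : realType) (alpha : R) : 0 < alpha -> alpha <= 1 ->
  0 <= 2 * alpha - alpha ^+ 2 <= 1.
Proof.
move=> alpha_gt0 alpha_le1.
have : 0 <= alpha * (2 - alpha) by rewrite mulr_ge0 ?subr_ge0//; lra.
by have : 0 <= (1 - alpha) ^+ 2 := sqr_ge0 _; lra.
Qed.

Lemma contraction_rate_bounds (R : realType) (q c : R) N : 0 <= q -> 2 * q < 1 ->
  0 <= c <= 1 -> (0 < N)%N ->
  0 <= (1 - 2 * q) ^+ 2 * c / (2 * pi * N%:R) <= 1 /\
  (1 - 2 * q) ^+ 2 * c / (2 * pi * N%:R) <= c * (1 - 2 * q) ^+ 2 / (4 * N%:R).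
Proof.
move=> q_ge0 q_lt /andP[c0 c1] N0; have piR := pi_ge2 R.
have q2 : 0 <= 1 - 2 * q <= 1 by lra.
have q21 : (1 - 2 * q) ^+ 2 <= 1 by rewrite expr_le1//; case/andP: q2.
have NR : 1 <= N%:R :> R by rewrite ler1n.
have NR0 : 0 < N%:R :> R by rewrite ltr0n.
have qc0 : 0 <= (1 - 2 * q) ^+ 2 * c by rewrite mulr_ge0 ?sqr_ge0.
have den4 : 4 * N%:R <= 2 * pi * N%:R :> R by rewrite ler_pM2r//; lra.
have den4_gt0 : 0 < 4 * N%:R :> R by rewrite mulr_gt0.
have den_gt0 := lt_le_trans den4_gt0 den4.
split; last first.
  by rewrite [c * _]mulrC ler_wpM2l// lef_pV2 ?posrE.
rewrite divr_ge0 ?(ltW den_gt0)//= ler_pdivrMr// mul1r.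
apply: (@le_trans _ _ 1); first by rewrite mulr_ile1// sqr_ge0.
by apply: le_trans den4; lra.
Qed.

(** The noise of one window is the rate times the limiting level. The constant is
    [16 * 4 * 2 pi = 128 pi]; one factor [psi^2] comes from [A^(k-1)] and the other from the second
    moment of the state. *)
Lemma noise_balance (R : realType) (psi rho eta s q c bC bB h N : R) k :
  s != 0 -> 1 - 2 * q != 0 -> 1 - rho != 0 -> N != 0 ->
  16 * c * ((bC * psi * rho ^+ k) ^+ 2 *
      (4 * psi ^+ 2 * (eta + h * bB * s) ^+ 2 / (1 - rho) ^+ 2)) / (N * s ^+ 2) =
  (1 - 2 * q) ^+ 2 * c / (2 * pi * N) * (128 * pi * psi ^+ 4 *
    (rho ^+ k * (bC / (1 - 2 * q) * (eta / s + h * bB)) / (1 - rho)) ^+ 2).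
Proof.
move=> s0 q0 rho0 N0; move: pi (pi_gt0 R) => a /lt0r_neq0 a0.
by field; rewrite s0 q0 rho0 N0 a0.
Qed.

(** * Measurability of the iterates and induction over the windows *)

Theorem theorem2 (R : realType) (psi : R) (psi_gt0 : 0 < psi) :
  exists2 K : R, 0 < K &
  forall (n m r k : nat) (n_gt0 : (0 < n)%N) (m_gt0 : (0 < m)%N)
    (r_gt0 : (0 < r)%N) (k_gt1 : (1 < k)%N)
    (A : 'M[R]_n) (B : 'M[R]_(n, m)) (C : 'M[R]_(r, n)) (D : 'M[R]_(r, m))
    (d : measure_display) (T : measurableType d) (P : probability T R)
    (x0 : {RV P >-> 'cV[R]_n}) (u : nat -> {RV P >-> 'cV[R]_m})
    (w : nat -> {RV P >-> 'cV[R]_n}) (xi : nat -> {RV P >-> bool})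
    (x : nat -> T -> 'cV[R]_n) (y : nat -> T -> 'cV[R]_r)
    (x_init : forall om, x 0%N om = x0 om)
    (x_step : forall t om, x t.+1 om = A *m x t om + B *m u t om + w t om)
    (y_eq : forall t om, y t om = C *m x t om + D *m u t om)
    (rho : R) (rho_ge0 : 0 <= rho) (rho_lt1 : rho < 1)
    (A_stable : forall t : nat, spectral_norm (A ^+ t) <= psi * rho ^+ t)
    (eta : R) (eta_gt0 : 0 < eta)
    (x0_psi2 : (psi2_norm P (fun om => euclidean_norm (x0 om)) <= eta%:E)%E)
    (w_psi2 : forall t, cond_psi2_norm_le P (attack_filtration x0 w t)
                          (fun om => euclidean_norm (w t om)) eta)
    (p : R) (p_ge0 : 0 <= p) (p_lt : p < (2 * (k - 1))%:R^-1)
    (xi_bernoulli : forall t (b : set bool),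
        distribution P (xi t) b = bernoulli_prob p b)
    (xi_indep : mutually_independent P
        (fun t => g_sigma_algebra_preimage (xi t)))
    (xi_indep_F : forall t, mutually_independent P
        (tnth [tuple g_sigma_algebra_preimage (xi t);
                     attack_filtration x0 w t]))
    (xi_attack : forall t,
        [set om | xi t om = false] `<=` [set om | w t om = 0])
    (sigma : R) (sigma_gt0 : 0 < sigma)
    (u_gaussian : forall t, is_isotropic_gaussian sigma (distribution P (u t)))
    (u_indep : mutually_independent P
        (fun t => g_sigma_algebra_preimage (u t)))
    (future_indep : forall t, mutually_independent P
        (tnth [tuple sigma_family [set s | (t <= s)%N] u;
                     sigma_family [set s | (t <= s)%N] xi;
                     history x0 w u t]))
    (alpha : R) (alpha_gt0 : 0 < alpha) (alpha_le1 : alpha <= 1),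
  let Gstar := markov_matrix A B C D k in
  let U (t : nat) (om : T) := stacked_input k (fun s => u s om) t in
  let f (t : nat) (om : T) (G : 'M[R]_(r, \sum_(j < k) m)) :=
    euclidean_norm (y (t + k - 1)%N om - G *m U (t + k - 1)%N om) in
  forall (G g : nat -> T -> 'M[R]_(r, \sum_(j < k) m)) (gamma : nat -> T -> R)
    (g_sel : nat ->
      'M[R]_(r, \sum_(j < k) m) * 'cV[R]_r * 'cV[R]_(\sum_(j < k) m) ->
      'M[R]_(r, \sum_(j < k) m))
    (gamma_sel : nat ->
      'M[R]_(r, \sum_(j < k) m) * 'cV[R]_r * 'cV[R]_(\sum_(j < k) m) -> R)
    (g_sel_meas : forall t, measurable_fun setT (g_sel t))
    (gamma_sel_meas : forall t, measurable_fun setT (gamma_sel t))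
    (g_selE : forall t om, (k %| t)%N ->
        g t om = g_sel t (G t om, y (t + k - 1)%N om, U (t + k - 1)%N om))
    (gamma_selE : forall t om, (k %| t)%N ->
        gamma t om =
        gamma_sel t (G t om, y (t + k - 1)%N om, U (t + k - 1)%N om))
    (g_subgradient : forall t, (k %| t)%N ->
        {ae P, forall om,
           subdifferential (f t om) (G t om) (g t om) /\ g t om != 0})
    (gamma_best : forall t, (k %| t)%N ->
        {ae P, forall om,
           let theta := frobenius_dot (g t om) (G t om - Gstar) /
                        frobenius_norm (g t om) ^+ 2 in
           Num.min (alpha * theta) ((2 - alpha) * theta) <= gamma t om
             <= Num.max (alpha * theta) ((2 - alpha) * theta)})
    (G_init : forall om, G 0%N om = 0)
    (G_step : forall t om, (k %| t)%N ->
        G (t + k)%N om = G t om - gamma t om *: g t om),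
  let q := 1 - (1 - p) ^+ (k - 1) in
  let nu := spectral_norm C / (1 - 2 * q) *
            (eta / sigma + Num.sqrt m%:R * spectral_norm B) in
  forall t : nat, (k %| t)%N ->
  ('E_P[fun om => (frobenius_norm (G t om - Gstar) ^+ 2)%R] <=
   (K * ((1 - (1 - 2 * q) ^+ 2 * (2 * alpha - alpha ^+ 2) /
              (2 * pi * (m * k)%:R)) ^+ (t %/ k)
           * frobenius_norm (0 - Gstar) ^+ 2
         + (rho ^+ (k - 1) * nu / (1 - rho)) ^+ 2))%:E)%E.
Proof.
have pi0 : 0 < pi :> R := pi_gt0 R.
have psi4_gt0 : 0 < psi ^+ 4 by rewrite exprn_gt0.
(* The induction gives the factor 1 on the initial error and [128 pi psi^4] on the noise; [K] has
   only to dominate both. *)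
exists (1 + 128 * pi * psi ^+ 4); first by rewrite addr_gt0// mulr_gt0// mulr_gt0.
move=> n m r k _ m_gt0 _ k_gt1 A B C D d T P x0 u w xi x y x_init x_step y_eq.
move=> rho rho_ge0 rho_lt1 A_stable eta eta_gt0 x0_psi2 w_psi2 p p_ge0 p_lt.
move=> xi_bernoulli xi_indep _ xi_attack s s_gt0 u_gaussian u_indep future_indep.
move=> alpha alpha_gt0 alpha_le1 Gstar U f G g gamma g_sel gamma_sel.
move=> g_sel_meas gamma_sel_meas g_selE gamma_selE g_subgradient gamma_best.
move=> G_init G_step q nu.
have k_gt0 : (0 < k)%N by exact: ltnW.
have NE : (\sum_(j < k) m = m * k)%N by rewrite sum_nat_const card_ord mulnC.
have [p_le1 q_ge0 q_lt] := attack_probability_bounds k_gt1 p_ge0 p_lt.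
rewrite -/q in q_ge0 q_lt.
have p01 : 0 <= p <= 1 by rewrite p_ge0.
have hist_sub t t' : (t <= t')%N ->
    history x0 w u t `<=` <<s history x0 w u t' >>.
  move=> tt' Z HZ; apply: sub_gen_smallest; move: Z HZ.
  apply: smallest_sub; first exact: smallest_sigma_algebra.
  move=> Z ZH; apply: sub_gen_smallest; case: ZH => [[Zx|[j /= jt Zw]]|[j /= jt Zu]].
  - by left; left.
  - by left; right; exists j => //=; exact: leq_trans tt'.
  - by right; exists j => //=; exact: leq_trans tt'.
have lift t t' d' (Y : measurableType d') (h : T -> Y) : (t <= t')%N ->
    measurable_fun setT (h : g_sigma_algebraType (history x0 w u t) -> Y) ->
    measurable_fun setT (h : g_sigma_algebraType (history x0 w u t') -> Y).
  by move=> tt'; exact: measurable_fun_g_sigma_algebra_sub (hist_sub _ _ tt').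
have mx0 t : measurable_fun setT
    (x0 : g_sigma_algebraType (history x0 w u t) -> 'cV[R]_n).
  (* Two inclusions of generators: [history] is already a generated sigma-algebra, and
     [g_sigma_algebraType] generates again from it. *)
  move=> _ Z mZ; do 2![apply: sub_gen_smallest]; left; left.
  by exists Z.
have mw t j : (j < t)%N -> measurable_fun setT
    (w j : g_sigma_algebraType (history x0 w u t) -> 'cV[R]_n).
  move=> jt _ Z mZ; do 2![apply: sub_gen_smallest]; left; right.
  by exists j => //; exists Z.
have mu t j : (j < t)%N -> measurable_fun setT
    (u j : g_sigma_algebraType (history x0 w u t) -> 'cV[R]_m).
  move=> jt _ Z mZ; do 2![apply: sub_gen_smallest]; right.
  by exists j => //; exists Z.
have mx t j : (j <= t)%N -> measurable_fun setT
    (x j : g_sigma_algebraType (history x0 w u t) -> 'cV[R]_n).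
  elim: j => [_|j IH jt]; first by rewrite (_ : x 0%N = x0)//; exact/funext.
  rewrite (_ : x j.+1 = fun om => A *m x j om + B *m u j om + w j om); last exact/funext.
  apply: measurable_mxD; last exact: mw.
  apply: measurable_mxD; apply: measurable_mxM => //; first exact: (IH (ltnW jt)).
  exact: mu.
have my t j : (j < t)%N -> measurable_fun setT
    (y j : g_sigma_algebraType (history x0 w u t) -> 'cV[R]_r).
  move=> jt; rewrite (_ : y j = fun om => C *m x j om + D *m u j om); last exact/funext.
  apply: measurable_mxD; apply: measurable_mxM => //; first exact: (mx t j (ltnW jt)).
  exact: mu.
have mU t j : (j < t)%N -> measurable_fun setT
    (U j : g_sigma_algebraType (history x0 w u t) -> 'cV[R]_(\sum_(j < k) m)).
  move=> jt; apply/measurable_fun_mxP => i i'.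
  have /measurable_fun_mxP mui := mu t (j - tagnat.sig1 i)%N (leq_ltn_trans (leq_subr _ _) jt).
  rewrite (_ : (fun om => U j om i i') = fun om => u (j - tagnat.sig1 i)%N om (tagnat.sig2 i) i').
    exact: mui.
  by apply/funext => om; rewrite /U /stacked_input mxE.
(* The selections are measurable functions of the iterate and of data up to time [j * k + k - 1], so
   the next iterate is determined by the history before [j.+1 * k]. This is what allows the error to
   be frozen while the next window is integrated out. *)
have mG j : measurable_fun setT
    (G (j * k)%N : g_sigma_algebraType (history x0 w u (j * k)) ->
      'M[R]_(r, \sum_(j < k) m)).
  elim: j => [|j IH].
    by rewrite mul0n (_ : G 0%N = fun=> 0); [exact: measurable_cst|exact/funext].
  have kj : (k %| j * k)%N by exact: dvdn_mull.
  have jk : (j * k <= j.+1 * k)%N by rewrite leq_mul2r leqnSn orbT.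
  have jk1 : (j * k + k - 1 < j.+1 * k)%N by rewrite mulSn addnC subn1 ltn_predL addn_gt0 k_gt0.
  pose arg om := (G (j * k)%N om, y (j * k + k - 1)%N om, U (j * k + k - 1)%N om).
  have marg : measurable_fun setT
      (arg : g_sigma_algebraType (history x0 w u (j.+1 * k)) -> _).
    apply: measurable_fun_pair; last exact: mU.
    by apply: measurable_fun_pair; [exact: lift IH|exact: my].
  rewrite (_ : G (j.+1 * k)%N = fun om => G (j * k)%N om
      - gamma_sel (j * k)%N (arg om) *: g_sel (j * k)%N (arg om)); last first.
    by apply/funext => om; rewrite mulSn addnC G_step// g_selE// gamma_selE.
  apply: measurable_mxB; first exact: lift IH.
  by apply: measurable_mxZ; exact: measurableT_comp marg.
have mem t := @measurable_fun_g_sigma_algebraW _ _ _ (@history_measurable _ _ _ P _ _ x0 u w t).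
pose c := 2 * alpha - alpha ^+ 2.
have c01 : 0 <= c <= 1 by exact: relaxation_gain_bounds.
have N_gt0 : (0 < m * k)%N by rewrite muln_gt0 m_gt0.
pose kappa := (1 - 2 * q) ^+ 2 * c / (2 * pi * (m * k)%:R).
have [kappa01 kappa_le] := contraction_rate_bounds q_ge0 q_lt c01 N_gt0.
rewrite -/kappa in kappa01 kappa_le.
pose e0 := frobenius_norm (0 - Gstar) ^+ 2.
pose z := (rho ^+ (k - 1) * nu / (1 - rho)) ^+ 2.
have z_ge0 : 0 <= z by exact: sqr_ge0.
pose noise := 128 * pi * psi ^+ 4 * z.
have noise_ge0 : 0 <= noise.
  by rewrite mulr_ge0// mulr_ge0 ?(ltW psi4_gt0)// mulr_ge0// ltW.
have integral_bound j : (\int[P]_om (frobenius_norm (G (j * k)%N om - Gstar) ^+ 2)%:E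
    <= ((1 - kappa) ^+ j * e0 + noise)%:E)%E.
  elim: j => [|j IH].
    rewrite expr0 mul1r mul0n.
    under eq_integral do rewrite G_init.
    by rewrite integral_cst//= probability_setT mule1 lee_fin lerDl.
  pose t := (j * k)%N; rewrite -/t in IH.
  have kt : (k %| t)%N by exact: dvdn_mull.
  pose tk := (t + k - 1)%N.
  pose E om := G t om - Gstar.
  have mE : measurable_fun setT
      (E : g_sigma_algebraType (history x0 w u t) -> 'M[R]_(r, \sum_(j < k) m)).
    by apply: measurable_mxB; [exact: mG|exact: measurable_cst].
  have mET := mem _ _ _ _ mE.
  pose V om := E om *m U tk om.
  pose b om := C *m (A ^+ (k - 1) *m x t om).
  pose att := attacked xi k t.
  have matt : measurable_fun setT att by exact: measurable_attacked.
  pose vv (i : 'I_(\sum_(j < k) m)) om := stacked_input k (fun i => u i om) (t + k - 1) i 0.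
  have UE om : U tk om = \col_i vv i om.
    by apply/matrixP => i i'; rewrite ord1 !mxE /vv /stacked_input mxE.
  have mvv i : measurable_fun setT (vv i) by exact: measurable_stacked_input.
  have hm : history x0 w u t `<=` measurable := @history_measurable _ _ _ P _ _ x0 u w t.
  have hI : setI_closed (history x0 w u t) := @historyI _ _ _ P _ _ x0 u w t.
  have hT : history x0 w u t setT := @historyT _ _ _ P _ _ x0 u w t.
  have vv_gauss : forall H (Z : 'I_(\sum_(j < k) m) -> set R), history x0 w u t H ->
      (forall i, measurable (Z i)) ->
      (P (H `&` [set om | forall i, Z i (vv i om)]) =
       P H * \prod_i normal_prob 0 s (Z i))%E.
    exact: stacked_input_gaussian.
  have mUT : measurable_fun setT (U tk).
    apply/measurable_fun_mxP => i i'.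
    by rewrite (_ : (fun om => U tk om i i') = vv i)//; apply/funext => om; rewrite ord1.
  have mVT : measurable_fun setT V by exact: measurable_mxM.
  have mbT : measurable_fun setT b.
    apply: measurable_mxM => //; apply: measurable_mxM => //.
    exact: mem (mx t t (leqnn t)).
  (* Square integrability of the iterates comes from the induction hypothesis itself. *)
  have e_fin : (\int[P]_om (frobenius_norm (E om) ^+ 2)%:E)%E \is a fin_num.
    rewrite ge0_fin_numE; last by apply: integral_ge0 => om _; rewrite lee_fin sqr_ge0.
    by apply: le_lt_trans IH _; rewrite ltry.
  pose e := fine (\int[P]_om (frobenius_norm (E om) ^+ 2)%:E)%E.
  have eE : (\int[P]_om (frobenius_norm (E om) ^+ 2)%:E)%E = e%:E by rewrite fineK.
  have e_le : e <= (1 - kappa) ^+ j * e0 + noise by rewrite -lee_fin -eE.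
  have sqnormE (a : R) : 0 <= a ->
      (\int[P]_om (a * frobenius_norm (E om) ^+ 2)%:E = (a * e)%:E)%E.
    move=> a0; under eq_integral do rewrite EFinM.
    rewrite ge0_integralZl//= ?eE//.
    - by apply/measurable_EFinP/measurable_funX; exact: measurable_frobenius_norm.
    - by move=> om _; rewrite lee_fin sqr_ge0.
  have LV_ge : ((3 / 4 * s * e)%:E <= \int[P]_om (frobenius_norm (E om) *
      euclidean_norm (V om))%:E + (3 / 16 * s * e)%:E)%E.
    have s_ge0 := ltW s_gt0.
    rewrite -!sqnormE ?mulr_ge0 ?divr_ge0//.
    have := @gaussian_norm_moment _ _ _ P _ _ vv s hm hI hT mvv s_gt0 vv_gauss r E mE.
    by under [X in (_ <= X + _)%E -> _]eq_integral do rewrite -UE.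
  have LW_E : (\int[P]_om (frobenius_norm (E om) ^+ 2 *
      euclidean_norm (U tk om) ^+ 2)%:E = ((m * k)%:R * s ^+ 2 * e)%:E)%E.
    rewrite -NE -sqnormE; last by rewrite mulr_ge0// sqr_ge0.
    have mL2 : measurable_fun setT ((fun om => frobenius_norm (E om) ^+ 2) :
        g_sigma_algebraType (history x0 w u t) -> R).
      by apply: measurable_funX; exact: measurable_frobenius_norm.
    rewrite -(@gaussian_sqnorm _ _ _ P _ _ vv s hm hI hT mvv s_gt0 vv_gauss _ mL2); last first.
      by move=> om; exact: sqr_ge0.
    by apply: eq_integral => om _; rewrite sqr_euclidean_norm.
  have attE : (\int[P]_om (frobenius_norm (E om) * euclidean_norm (V om)
      * (att om)%:R)%:E =
      q%:E * \int[P]_om (frobenius_norm (E om) * euclidean_norm (V om))%:E)%E.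
    (* [|E| |E U|] depends on the history and on every input of the window, so the attack flag has
       to be separated from the pi-system generating both. *)
    pose Q := cylinders (history x0 w u t) vv (\sum_(j < k) m).
    pose attm : {mfun T >-> bool} := HB.pack att (isMeasurableFun.Build _ _ _ _ _ matt).
    rewrite -(@prob_attacked _ _ _ P xi p xi_bernoulli xi_indep k t p01).
    have EQ : measurable_fun setT (E : g_sigma_algebraType Q -> 'M[R]_(r, \sum_(j < k) m)).
      apply: measurable_fun_g_sigma_algebra_sub mE => Z HZ.
      by apply: sub_gen_smallest; exact: sub_cylinders.
    have UQ : measurable_fun setT (U tk : g_sigma_algebraType Q -> 'cV[R]_(\sum_(j < k) m)).
      apply/measurable_fun_mxP => i i'.
      rewrite (_ : (fun om => U tk om i i') = vv i); last by apply/funext => om; rewrite ord1.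
      exact: measurable_fun_coordinate.
    apply: (@independent_bool_expectation _ _ _ P Q attm).
    - exact: cylinders_measurable.
    - exact: cylindersI.
    - exact: cylindersT.
    - by move=> H Z; exact: attacked_independent.
    - apply: measurable_funM; first exact: measurable_frobenius_norm.
      by apply: measurable_euclidean_norm; exact: measurable_mxM.
    - by move=> om; rewrite mulr_ge0 ?frobenius_norm_ge0 ?euclidean_norm_ge0.
  pose b1 := spectral_norm C * psi * rho ^+ (k - 1).
  pose B0 := b1 ^+ 2 * (4 * psi ^+ 2 * (eta + Num.sqrt m%:R * spectral_norm B * s) ^+ 2
     / (1 - rho) ^+ 2).
  have rho01 : 0 <= rho < 1 by rewrite rho_ge0.
  have xt_le := @state_second_moment _ _ _ P _ _ x0 u w s eta s_gt0 eta_gt0 u_gaussian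
    x0_psi2 w_psi2 A B x psi rho t x_init x_step psi_gt0 rho01 A_stable
    (mem _ _ _ _ (mx t t (leqnn t))).
  have b_le : (\int[P]_om (euclidean_norm (b om) ^+ 2)%:E <= B0%:E)%E.
    have mxt2 : measurable_fun setT (fun om => (euclidean_norm (x t om) ^+ 2)%:E).
      apply/measurable_EFinP/measurable_funX; apply: measurable_euclidean_norm.
      exact: mem (mx t t (leqnn t)).
    have b1_ge0 : 0 <= b1.
      by rewrite !mulr_ge0 ?spectral_norm_ge0 ?exprn_ge0// ltW.
    apply: (@le_trans _ _ (\int[P]_om ((b1 ^+ 2)%:E * (euclidean_norm (x t om) ^+ 2)%:E))%E).
      apply: ge0_le_integral => //=.
      - by move=> om _; rewrite lee_fin sqr_ge0.
      - by apply/measurable_EFinP/measurable_funX; exact: measurable_euclidean_norm.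
      - exact: measurable_funeM.
      - move=> om _; rewrite -EFinM lee_fin -exprMn.
        rewrite ler_sqr ?nnegrE ?euclidean_norm_ge0//; last first.
          by rewrite mulr_ge0// euclidean_norm_ge0.
        exact: (attack_free_observation_norm C (x ^~ om) _ _ A_stable).
    rewrite ge0_integralZl//=; last 2 first.
    - by move=> om _; rewrite lee_fin sqr_ge0.
    - by rewrite lee_fin sqr_ge0.
    by rewrite [leRHS]EFinM lee_wpmul2l// lee_fin sqr_ge0.
  have step beta : 0 <= beta -> {ae P, forall om,
      frobenius_norm (G (j.+1 * k)%N om - Gstar) ^+ 2
        + c * (2 * (beta * frobenius_norm (E om)) * euclidean_norm (V om)) <=
      frobenius_norm (E om) ^+ 2 +
        c * (4 * (beta * frobenius_norm (E om)) * euclidean_norm (V om) * (att om)%:R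
          + 4 * (beta * frobenius_norm (E om)) * euclidean_norm (b om)
          + (beta * frobenius_norm (E om)) ^+ 2 * euclidean_norm (U tk om) ^+ 2)}.
    move=> beta0.
    apply: filterS2 (g_subgradient t kt) (gamma_best t kt) => om [g_sub g_neq0] g_best.
    rewrite mulSn addnC G_step//.
    have alpha01 : 0 <= alpha <= 1 by rewrite ltW.
    have lam_ge0 : 0 <= beta * frobenius_norm (E om).
      by rewrite mulr_ge0// frobenius_norm_ge0.
    have no_attack : ~~ att om -> y tk om - Gstar *m U tk om = b om.
      move=> no_att.
      apply: (attack_free_observation (x_step ^~ om) (y_eq ^~ om)) => // i ik.
      apply: xi_attack => /=; apply/negbTE; apply: contra no_att => xi_i.
      by apply/existsP; exists (Ordinal ik).
    exact: (best_step g_sub alpha01 lam_ge0 g_neq0 no_attack g_best).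
  have mEp : measurable_fun setT (fun om => frobenius_norm (G (j.+1 * k)%N om - Gstar)).
    apply: measurable_frobenius_norm; apply: measurable_mxB => //.
    exact: mem (mG j.+1).
  have c_ge0 : 0 <= c by case/andP: c01.
  have := @expected_step _ T R P (fun om => frobenius_norm (E om))
    (fun om => euclidean_norm (V om)) (fun om => euclidean_norm (U tk om))
    (fun om => euclidean_norm (b om))
    (fun om => frobenius_norm (G (j.+1 * k)%N om - Gstar)) att c q s B0 e (m * k)%N
    c_ge0 q_ge0 q_lt s_gt0 N_gt0 (measurable_frobenius_norm mET)
    (measurable_euclidean_norm mVT) (measurable_euclidean_norm mUT)
    (measurable_euclidean_norm mbT) mEp matt
    (fun om => frobenius_norm_ge0 _)
    (fun om => introT andP (conj (euclidean_norm_ge0 _) (euclidean_norm_mulmx _ _)))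
    (fun om => euclidean_norm_ge0 _) (fun om => euclidean_norm_ge0 _)
    step eE attE LW_E LV_ge b_le.
  move=> /le_trans; apply; rewrite lee_fin.
  have e_ge0 : 0 <= e.
    by rewrite -lee_fin -eE; apply: integral_ge0 => om _; rewrite lee_fin sqr_ge0.
  rewrite [(1 - kappa) ^+ _]exprS; apply: (contraction_step kappa01 e_le).
  (* Since [e >= 0], the proved rate may be lowered to the claimed [kappa]; the noise term is then
     exactly [kappa * noise]. *)
  apply: lerD; first by rewrite ler_wpM2r// lerD2l lerN2.
  rewrite /B0 /b1 /noise /z /nu /kappa (noise_balance _ _ _ _ _ _ _ (q := q)) ?gt_eqF//.
  - by rewrite subr_gt0.
  - by rewrite subr_gt0.
  - by rewrite ltr0n.
move=> t kt; rewrite unlock.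
have := integral_bound (t %/ k)%N; rewrite divnK// => /le_trans; apply.
rewrite lee_fin -/c -/kappa -/e0 -/z mulrDl mul1r.
have a_ge0 : 0 <= (1 - kappa) ^+ (t %/ k) * e0.
  by rewrite mulr_ge0 ?sqr_ge0// exprn_ge0// subr_ge0; case/andP: kappa01.
have K0 : 0 <= 128 * pi * psi ^+ 4 by rewrite mulr_ge0 ?(ltW psi4_gt0)// mulr_ge0// ltW.
by apply: lerD; [rewrite lerDl|rewrite ler_wpM2l// lerDr].
Qed.
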